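(* Consider the shape invariant model $Y_{i,j}=a_jf(X_i-\theta_j)+v_j+\varepsilon_{i,j}$, $1\le j\le p$, $i\ge 1$, under the assumptions listed in the context, with the estimators $\widehat v_n$, $\widehat\theta_n$, $\widehat a_n$ and the weighted recursive Nadaraya-Watson estimator $\widehat f_n$ defined in the context, with bandwidth $h_n=1/n^\alpha$, $\alpha\in\,]0,1[$. Assume that $f$ is Lipschitz and that the sequence $(\varepsilon_{i,j})$ has a finite moment of order $>2$. Then, for any $x\in[-1/2,1/2]$, $$\lim_{n\to\infty}\widehat f_n(x)=f(x)\quad\text{a.s.}$$
   Context: Setting. Let $p\ge2$ be an integer. - The observation times $(X_i)$ are independent and identically distributed with probability density function $g$, positive on its support $[-1/2,1/2]$. In addition, $g$ is continuous on $\mathbb R$, twice differentiable with bounded derivatives. - The shape function $f$ is symmetric ($f(-x)=f(x)$), bounded, periodic with period $1$, and $\int_{-1/2}^{1/2}f(x)\,dx=0$. Its first Fourier coefficient $f_1=\int_{-1/2}^{1/2}\cos(2\pi x)f(x)\,dx$ satisfies $f_1\ne0$ and is supposed known. - $a=(a_1,\dots,a_p)^T$, $\theta=(\theta_1,\dots,\theta_p)^T$, $v=(v_1,\dots,v_p)^T$ are vectors of $\mathbb R^p$ with $a_j\ne0$ for all $j$, $a_1=1$, $\theta_1=0$ and $\max_{1\le j\le p}|\theta_j|<1/4$. - The noise $(\varepsilon_{i,j})$ is a sequence of independent random variables with mean zero and variances $\mathbb E[\varepsilon_{i,j}^2]=\sigma_j^2$, independent of the random points $X_i$; for each $j$, the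 variables $(\varepsilon_{i,j})_i$ share the same distribution. Estimators (for $1\le j\le p$). - $\widehat v_{n,j}=\frac1n\sum_{i=1}^n\frac{Y_{i,j}}{g(X_i)}$ for $n\ge1$, with $\widehat v_{0,j}$ an arbitrary constant. - With $\pi$ the projection of $\mathbb R$ onto $[-1/4,1/4]$, $\widehat\theta_0\in[-1/4,1/4]^p$ and, for $n\ge0$, $\widehat\theta_{n+1,j}=\pi\Bigl(\widehat\theta_{n,j}+\frac1{n+1}\mathrm{sign}(a_jf_1)\frac{\sin(2\pi(X_{n+1}-\widehat\theta_{n,j}))}{g(X_{n+1})}Y_{n+1,j}\Bigr)$. - $\widehat a_{n,j}=\frac1{nf_1}\sum_{i=1}^n\frac{\cos(2\pi(X_i-\widehat\theta_{i-1,j}))}{g(X_i)}Y_{i,j}$. - The kernel $K$ is a nonnegative symmetric function on $\mathbb R$, bounded with compact support, with $\int_{\mathbb R}K(x)\,dx=1$ and $\int_{\mathbb R}K^2(x)\,dx=\nu^2$. Put $W_{n,j}(x)=\frac1{h_n}K\Bigl(\frac{X_n-\widehat\theta_{n-1,j}-x}{h_n}\Bigr)$. - The weights $\omega_j$ satisfy $\omega_j(x)=\omega_j(-x)$, $\omega_j(x)\ge0$ and $\sum_{j=1}^p\omega_j(x)=1$. - $\widehat f_n(x)=\sum_{j=1}^p\omega_j(x)\widehat f_{n,j}(x)$, where $$\widehat f_{n,j}(x)=\frac1{\widehat a_{n,j}}\,\frac{\sum_{i=1}^n\bigl(W_{i,j}(x)+W_{i,j}(-x)\bigr)\bigl(Y_{i,j}-\widehat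 v_{i-1,j}\bigr)}{\sum_{i=1}^n\bigl(W_{i,j}(x)+W_{i,j}(-x)\bigr)}.$$
   Formalization: A density positive on its support [-1/2,1/2] cannot be continuous on R; here g is continuous only relative to [-1/2,1/2] and twice differentiable with bounded derivatives on the open interval, positivity on the closed support being kept. *)

(* Defs.v *)
From HB Require Import structures.
From mathcomp Require Import all_boot all_order all_algebra.
From mathcomp Require Import all_classical all_reals all_analysis.

Set Implicit Arguments.
Unset Strict Implicit.
Unset Printing Implicit Defensive.

Import Order.TTheory GRing.Theory Num.Theory.
Import numFieldNormedType.Exports.

Local Open Scope classical_set_scope.
Local Open Scope ring_scope.

Section probability.
Context (d : measure_display) (T : measurableType d) (R : realType).
Variable P : probability T R.

Definition mutually_independent (I : eqType) (Z : I -> {RV P >-> R}) : Prop :=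
  forall (s : seq I) (B : I -> set R), uniq s ->
    (forall i, measurable (B i)) ->
    P (\big[setI/setT]_(i <- s) (Z i @^-1` B i)) =
    (\prod_(i <- s) P (Z i @^-1` B i))%E.

Definition sigma_of_family (I : Type) (Z : I -> {RV P >-> R}) : set (set T) :=
  <<s [set A | exists i, exists2 B : set R, measurable B & A = Z i @^-1` B] >>.

Definition independent_families (I J : Type)
    (Z : I -> {RV P >-> R}) (W : J -> {RV P >-> R}) : Prop :=
  forall A B : set T, sigma_of_family Z A -> sigma_of_family W B ->
    P (A `&` B) = (P A * P B)%E.

Definition identically_distributed (I : Type) (Z : I -> {RV P >-> R}) : Prop :=
  forall (i k : I) (A : set R), measurable A ->
    distribution P (Z i) A = distribution P (Z k) A.

Definition has_density (Z : {RV P >-> R}) (g : R -> R) : Prop :=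
  forall A : set R, measurable A ->
    distribution P Z A = (\int[lebesgue_measure]_(x in A) (g x)%:E)%E.

End probability.

Section densities.
Context (R : realType).

Definition is_pdf (g : R -> R) : Prop :=
  [/\ measurable_fun setT g, forall x, 0 <= g x
    & (\int[lebesgue_measure]_x (g x)%:E)%E = 1%E].

Definition fun_support (g : R -> R) : set R := closure [set x | g x != 0].

(* A density supported by, and positive on, the whole closed interval [l, r]
   jumps at l and at r, so its regularity can only be required relative to
   [l, r]: continuity for the topology induced on [l, r], and existence and
   boundedness of the two derivatives in the interior. *)
Definition regular_on_segment (l r : R) (g : R -> R) : Prop :=
  [/\ {within `[l, r], continuous g},
      forall x : R, x \in `]l, r[ -> derivable g x 1 /\ derivable (g^`())%classic x 1,
      [bounded (g^`())%classic x | x in `]l, r[]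
    & [bounded (g^`(2))%classic x | x in `]l, r[]].

End densities.

Section estimators.
Context (R : realType) (p : nat).

Definition fourier1 (f : R -> R) : R :=
  \int[lebesgue_measure]_(x in `[- (1 / 2), 1 / 2]) (cos (2 * pi * x) * f x).

Definition proj_quarter (t : R) : R := Num.max (- (1 / 4)) (Num.min (1 / 4) t).

(* The estimators are functions of the data: [x i] is the i-th observation time
   and [y i j] the i-th observation of the j-th curve, for i >= 1 ([x 0] and
   [y 0] are never used). [f1] is the known Fourier coefficient, [theta0] and
   [v0] are the arbitrary initial values. *)
Variables (g : R -> R) (a : 'I_p -> R) (f1 : R) (theta0 v0 : 'I_p -> R).
Variables (K : R -> R) (h : nat -> R) (omega : 'I_p -> R -> R).
Variables (x : nat -> R) (y : nat -> 'I_p -> R).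

Definition vhat (n : nat) (j : 'I_p) : R :=
  if n == 0%N then v0 j
  else 1 / n%:R * \sum_(1 <= i < n.+1) y i j / g (x i).

Fixpoint thetahat (n : nat) (j : 'I_p) : R :=
  if n is m.+1 then
    proj_quarter
      (thetahat m j + 1 / m.+1%:R * Num.sg (a j * f1) *
         (sin (2 * pi * (x m.+1 - thetahat m j)) / g (x m.+1)) * y m.+1 j)
  else theta0 j.

Definition ahat (n : nat) (j : 'I_p) : R :=
  1 / (n%:R * f1) *
  \sum_(1 <= i < n.+1)
     cos (2 * pi * (x i - thetahat i.-1 j)) / g (x i) * y i j.

Definition nw_weight (n : nat) (j : 'I_p) (t : R) : R :=
  1 / h n * K ((x n - thetahat n.-1 j - t) / h n).

Definition fhat_comp (n : nat) (j : 'I_p) (t : R) : R :=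
  1 / ahat n j *
  ((\sum_(1 <= i < n.+1)
       (nw_weight i j t + nw_weight i j (- t)) * (y i j - vhat i.-1 j)) /
   (\sum_(1 <= i < n.+1) (nw_weight i j t + nw_weight i j (- t)))).

Definition fhat (n : nat) (t : R) : R :=
  \sum_(j < p) omega j t * fhat_comp n j t.

End estimators.

(* Main.v *)
(** No martingale theory is needed.  For nonnegative uncorrelated terms whose
    variances grow like n^alpha with alpha < 1, Chebyshev's inequality along
    n = k^q and monotonicity between consecutive powers give a strong law.  It
    applies to psi_i(tau_(i-1), X_i) eta(eps_i), with tau_(i-1) a function of the
    past and eta the positive or the negative part, since (X_i, eps_i) is
    independent of the past.

    The estimators of v and, once tau_n tends to theta, of a follow at once, and
    so do the denominator of the Nadaraya-Watson ratio and its noise term; the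
    remaining bias tends to 0 pathwise because f is Lipschitz.

    For tau_n itself, V_n = (tau_n - theta)^2 satisfies
    E V_(n+1) <= E V_n - 2 E G(tau_n) / (n+1) + C / (n+1)^2, with
    G(t) = |a f_1| (t - theta) sin (2 pi (t - theta)), so that the series of
    G(tau_n) / (n+1) converges almost surely.  As |tau_(n+1) - tau_n| is at most
    C (1 + |eps_(n+1)|) / (n+1), tau_n oscillates too slowly for this unless it
    tends to theta. *)
Require Import Defs.
From HB Require Import structures.
From mathcomp Require Import all_boot all_order all_algebra.
From mathcomp Require Import all_classical all_reals all_analysis.
From mathcomp Require Import measurable_realfun.
From mathcomp Require Import ring lra.

Import Order.TTheory GRing.Theory Num.Theory.
Import numFieldNormedType.Exports.

Local Open Scope classical_set_scope.
Local Open Scope ring_scope.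

(** * Convergence of real sequences *)

Section deterministic.
Set Implicit Arguments.
Unset Strict Implicit.
Context {R : realType}.
Implicit Types (U m w d tau B b : nat -> R).

(** A kernel weight can be as large as n^alpha, but its mean stays bounded, so its second moment is
    of order n^alpha and not n^(2 alpha); this is what makes the whole range alpha < 1 accessible.
    Nonnegativity is the price of interpolating between sparse indices, and it is why signed
    quantities are always split or shifted before a strong law is applied.

    Two obstacles shape the rest. The density jumps at the ends of its support, and the window
    around theta + x may lie outside it when x is near 1/2 or -1/2. The symmetrised weights repair
    this: one of the windows around theta + x and theta - x keeps half of its mass, and both
    estimate the same value because f is even. Next, convergence of the series of G(tau_n) / (n+1)
    by itself only makes G(tau_n) small along a subsequence, and unbounded noise prevents a uniform
    bound on the steps. Over the indices from n to n + n/D, however, tau moves by O(1/D) + o(1),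
    while these indices carry a harmonic mass of order 1/D.

    Indices start at 0: index i stands for observation i+1, and tau_i is the estimate available just
    before it. *)

Lemma cvg_near_eq (u w : nat -> R) (l l' : R) : u n @[n --> \oo] --> l' -> l' = l ->
  (\forall n \near \oo, u n = w n) -> w n @[n --> \oo] --> l.
Proof. by move=> h <- uw; apply: cvg_trans h; exact: near_eq_cvg. Qed.

Lemma cvg_sum (I : Type) (r : seq I) (u : I -> nat -> R) (l : I -> R) :
  (forall i, u i n @[n --> \oo] --> l i) ->
  \sum_(i <- r) u i n @[n --> \oo] --> \sum_(i <- r) l i.
Proof.
move=> h; elim: r => [|i r IH].
  by rewrite big_nil; apply: (cvg_near_eq (cvg_cst 0)) => //; near=> n; rewrite big_nil.
rewrite big_cons; apply: (cvg_near_eq (cvgD (h i) IH)) => //.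
by near=> n; rewrite big_cons.
Unshelve. all: by end_near. Qed.

Lemma nat_root (q n : nat) : (0 < q)%N ->
  exists k, (k ^ q <= n < k.+1 ^ q)%N.
Proof.
move=> q0.
have ex : exists k, (k ^ q <= n)%N by exists 0%N; rewrite exp0n.
have bd k : (k ^ q <= n)%N -> (k <= n)%N.
  move=> kn; apply: leq_trans kn; case: k => // -[|k]; first by rewrite exp1n.
  by rewrite -{1}(expn1 k.+2) leq_pexp2l.
case: (ex_maxnP ex bd) => k kn kmax; exists k; rewrite kn/= ltnNge.
by apply/negP => /kmax; rewrite ltnn.
Qed.

Lemma ratio_succ_pow (q : nat) :
  ((k.+1 ^ q)%:R / (k ^ q)%:R : R) @[k --> \oo] --> (1 : R).
Proof.
rewrite -(cvg_shiftS (fun k => ((k.+1 ^ q)%:R / (k ^ q)%:R : R))) /=.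
have -> : (fun k => ((k.+2 ^ q)%:R / (k.+1 ^ q)%:R : R)) =
          (fun k => (1 + k.+1%:R^-1 : R) ^+ q).
  apply/funext => k; rewrite !natrX -expr_div_n; congr (_ ^+ _).
  by rewrite -(addn1 k.+1) natrD mulrDl divff ?pnatr_eq0// mul1r.
suff : ((1 + k.+1%:R^-1 : R) ^+ q) @[k --> \oo] --> ((1 + 0 : R) ^+ q).
  by rewrite addr0 expr1n.
apply: (@cvg_comp _ _ _ (fun k => 1 + k.+1%:R^-1 : R) (fun x => x ^+ q) _ (nbhs (1 + 0 : R))); last first.
  exact: exprn_continuous.
by apply: cvgD; [exact: cvg_cst|exact: cvg_harmonic].
Qed.

(* Between two consecutive q-th powers the sums of U are squeezed by
   monotonicity, while those of m vary by at most C times the gap. *)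
Lemma cesaro_of_subsequence U m (C : R) (q : nat) : (0 < q)%N ->
  (forall n, 0 <= U n) -> (forall n, 0 <= m n <= C) ->
  ((k ^ q)%:R^-1 * \sum_(i < k ^ q) (U i - m i)) @[k --> \oo] --> (0 : R) ->
  (n%:R^-1 * \sum_(i < n) (U i - m i)) @[n --> \oo] --> (0 : R).
Proof.
move=> q0 U0 mC Scvg.
set S := fun n => \sum_(i < n) (U i - m i).
have C0 : 0 <= C by have /andP[] := mC 0%N; exact: le_trans.
have US a c : (a <= c)%N -> S a - C * (c - a)%:R <= S c.
  move=> ac; rewrite /S -!(big_mkord xpredT (fun i => U i - m i)).
  rewrite (big_cat_nat _ (n := a) (m:=0%N) (p:=c))//=.
  rewrite lerD2l lerNl -sumrN.
  apply: (@le_trans _ _ (\sum_(a <= i < c) C)).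
    apply: ler_sum => i _; rewrite opprB lerBlDr.
    by apply: le_trans (_ : C <= _); [case/andP: (mC i)|rewrite lerDl].
  by rewrite sumr_const_nat mulr_natr.
have /cvgrPdist_le rho := ratio_succ_pow q.
apply/cvgrPdist_le => e e0.
have e3 : 0 < e / 4 by rewrite divr_gt0.
(* Bounding the relative gap by 1 gives (k+1)^q <= 2 k^q; the other bound makes [C] times the gap at
   most e/4 k^q. *)
have e4 : 0 < Num.min 1 (e / 4 / (C + 1)).
  by rewrite lt_min ltr01/= divr_gt0// ltr_wpDl.
move/cvgrPdist_le : Scvg => /(_ _ e3)[K1 _ HK1].
have [K2 _ HK2] := rho _ e4.
near=> n.
have [k /andP[kn nk]] := nat_root n q0.
have kK : (maxn 1 (maxn K1 K2) <= k)%N.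
  rewrite -ltnS -(ltn_exp2r _ _ q0); apply: leq_ltn_trans nk.
  by near: n; exact: nbhs_infty_ge.
have k0 : (0 < k)%N by apply: leq_trans kK; rewrite leq_max.
have kK1 : (K1 <= k)%N by apply: leq_trans kK; rewrite !leq_max leqnn orbT.
have kK2 : (K2 <= k)%N by apply: leq_trans kK; rewrite !leq_max leqnn !orbT.
have kq0 : 0 < (k ^ q)%:R :> R by rewrite ltr0n expn_gt0 k0.
have kkle : (k ^ q <= k.+1 ^ q)%N by rewrite leq_exp2r.
have n0 : 0 < n%:R :> R.
  by apply: lt_le_trans kq0 _; rewrite ler_nat.
have := HK2 _ kK2; rewrite distrC ler_norml => /andP[_ Hr].
have gap : (k.+1 ^ q - k ^ q)%:R <= Num.min 1 (e / 4 / (C + 1)) * (k ^ q)%:R :> R.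
  rewrite -ler_pdivrMr// natrB// mulrBl divff ?gt_eqF//.
have gap1 : (k.+1 ^ q - k ^ q)%:R <= (k ^ q)%:R :> R.
  by apply: (le_trans gap); rewrite ler_piMl ?(ltW kq0)// ge_min lexx.
have gap2 : C * (k.+1 ^ q - k ^ q)%:R <= e / 4 * (k ^ q)%:R :> R.
  apply: (@le_trans _ _ (C * (e / 4 / (C + 1) * (k ^ q)%:R))).
    rewrite ler_wpM2l//; apply: (le_trans gap).
    by rewrite ler_wpM2r ?(ltW kq0)// ge_min lexx orbT.
  have C1 : C / (C + 1) <= 1 by rewrite ler_pdivrMr ?ltr_wpDl// mul1r lerDl.
  have -> : C * (e / 4 / (C + 1) * (k ^ q)%:R) = e / 4 * (k ^ q)%:R * (C / (C + 1)).
    by field; rewrite lt0r_neq0// ltr_wpDl.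
  by rewrite ler_piMr// mulr_ge0 ?(ltW e3)// ltW.
have S1 := HK1 _ kK1; have S2 := HK1 _ (leqW kK1).
rewrite /= sub0r normrN normrM gtr0_norm ?invr_gt0// in S1.
rewrite ler_pdivrMl// mulrC in S1.
have kk0 : 0 < (k.+1 ^ q)%:R :> R by rewrite ltr0n expn_gt0.
rewrite /= sub0r normrN normrM gtr0_norm ?invr_gt0// in S2.
rewrite ler_pdivrMl// mulrC in S2.
rewrite sub0r normrN normrM gtr0_norm ?invr_gt0// ler_pdivrMl// mulrC.
rewrite -!/(S _) in S1 S2 *.
have kn' : (k ^ q)%:R <= n%:R :> R by rewrite ler_nat.
have up : (k.+1 ^ q)%:R <= 2 * (k ^ q)%:R :> R.
  by rewrite -(subnK kkle) natrD mulr_natl mulr2n lerD2r.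
(* [S n] is bounded below from k^q and above from (k+1)^q; the errors add up to at most 3/4 e
   k^q. *)
have H1 := US _ _ kn; have H2 := US _ _ (ltnW nk).
have H1' : C * (n - k ^ q)%:R <= e / 4 * (k ^ q)%:R.
  apply: le_trans gap2; rewrite ler_wpM2l// ler_nat leq_sub2r// ltnW//.
have H2' : C * (k.+1 ^ q - n)%:R <= e / 4 * (k ^ q)%:R.
  apply: le_trans gap2; rewrite ler_wpM2l// ler_nat leq_sub2l//.
rewrite !ler_norml in S1 S2 *; case/andP: S1 => S1 S1'; case/andP: S2 => S2 S2'.
have en : e * (k ^ q)%:R <= e * n%:R by apply: ler_wpM2l => //; exact: ltW.
have eup := ler_wpM2l (ltW e0) up.
have ek := mulr_gt0 e0 kq0.
by apply/andP; split; lra.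
Unshelve. all: by end_near. Qed.

(** Only the averages of the weights are bounded, which admits kernel weights and 1 + |e_i|. Past
    the index where [d] is small the sum is at most e/2 n; the finitely many earlier terms are
    absorbed as n grows. *)
Lemma weighted_cesaro w d (C : R) :
  d n @[n --> \oo] --> (0 : R) -> (forall n, 0 <= w n) ->
  (forall n, \sum_(i < n) w i <= C * n%:R) ->
  (n%:R^-1 * \sum_(i < n) w i * d i) @[n --> \oo] --> (0 : R).
Proof.
move=> d0 w0 wC.
have C0 : 0 <= C.
  by have := wC 1%N; rewrite mulr1; apply: le_trans; apply: sumr_ge0.
apply/cvgrPdist_le => e e0.
have e1 : 0 < e / 2 / (C + 1) by rewrite !divr_gt0// ltr_wpDl.
move/cvgrPdist_le : d0 => /(_ _ e1)[N _ HN].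
set A := \sum_(i < N) w i * `|d i|.
have A0 : 0 <= A by apply: sumr_ge0 => i _; rewrite mulr_ge0.
near=> n.
have Nn : (N <= n)%N by near: n; exact: nbhs_infty_ge.
have n0 : 0 < n%:R :> R by rewrite ltr0n; near: n; exact: nbhs_infty_gt.
have An : A / (e / 2) <= n%:R by near: n; exact: nbhs_infty_ger.
rewrite sub0r normrN normrM gtr0_norm ?invr_gt0// ler_pdivrMl// mulrC.
apply: (le_trans (ler_norm_sum _ _ _)).
rewrite -(big_mkord xpredT (fun i => `|w i * d i|)) (big_cat_nat (n := N))//=.
rewrite big_mkord.
have -> : \sum_(i < N) `|w i * d i| = A.
  by apply: eq_bigr => i _; rewrite normrM ger0_norm.
rewrite ler_pdivrMr ?divr_gt0// in An.
have : \sum_(N <= i < n) `|w i * d i| <= (e / 2 / (C + 1)) * (C * n%:R).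
  apply: (@le_trans _ _ (\sum_(N <= i < n) (e / 2 / (C + 1)) * w i)).
    apply: ler_sum_nat => i /andP[Ni _]; rewrite normrM ger0_norm// mulrC ler_wpM2r//.
    by have := HN _ Ni; rewrite /= sub0r normrN.
  rewrite -mulr_sumr ler_wpM2l ?(ltW e1)//.
  apply: le_trans (wC n); rewrite -(big_mkord xpredT) (big_cat_nat (n := N) (m := 0%N))//=.
  by rewrite lerDr sumr_ge0.
have : (e / 2 / (C + 1)) * (C * n%:R) <= e / 2 * n%:R.
  have C1 : C / (C + 1) <= 1 by rewrite ler_pdivrMr ?ltr_wpDl// mul1r lerDl.
  rewrite mulrA ler_wpM2r// -mulrA ler_piMr ?divr_ge0 ?(ltW e0)//.
  by rewrite mulrC.
lra.
Unshelve. all: by end_near. Qed.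

(** If tau_n were farther than e from theta at a large n, tau would stay e/2 away for all indices
    from n to n + n/D, and this window would add at least k/(4D) to a convergent series. The bounds
    [B] on the steps are controlled in the mean only: over a window their sum is a sum of [b], hence
    at most [C] times the length, plus a difference of two partial sums that are o(n). *)
Lemma slow_oscillation_cvg tau B b (C M theta : R) (G : R -> R) :
  (forall n, `|tau n.+1 - tau n| <= B n / n.+1%:R) ->
  (forall n, 0 <= B n) -> (forall n, b n <= C) ->
  (n%:R^-1 * \sum_(i < n) (B i - b i)) @[n --> \oo] --> (0 : R) ->
  (forall n, 0 <= G (tau n)) ->
  (forall N, \sum_(n < N) G (tau n) / n.+1%:R <= M) ->
  (forall e, 0 < e -> exists2 k, 0 < k &
     forall n, e <= `|tau n - theta| -> k <= G (tau n)) ->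
  tau n @[n --> \oo] --> theta.
Proof.
move=> tauB B0 bC Scvg G0 GM Gk.
set u := fun N => \sum_(n < N) G (tau n) / n.+1%:R.
have usub n k : (n <= k)%N ->
    u k - u n = \sum_(n <= i < k) G (tau i) / i.+1%:R.
  move=> nk; rewrite /u -!(big_mkord xpredT (fun n => G (tau n) / n.+1%:R)).
  by rewrite (big_cat_nat (n := n) (m := 0%N) (p := k))//= addrAC subrr add0r.
have ucvg : cvgn u.
  apply: nondecreasing_is_cvgn.
    by move=> n k nk; rewrite -subr_ge0 usub// sumr_ge0// => i _; rewrite divr_ge0.
  by exists M => _ [n _ <-]; exact: GM.
set s := fun n => \sum_(i < n) (B i - b i).
have tausub n k l : (0 < n)%N -> (n <= k)%N -> (k <= l)%N ->
    `|tau k - tau n| <= n%:R^-1 * (`|s l| + `|s n| + C * (l - n)%:R).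
  move=> n0 nk kl.
  have -> : tau k - tau n = \sum_(n <= i < k) (tau i.+1 - tau i).
    by rewrite telescope_sumr.
  apply: (le_trans (ler_norm_sum _ _ _)).
  apply: (@le_trans _ _ (\sum_(n <= i < k) n%:R^-1 * B i)).
    apply: ler_sum_nat => i /andP[ni _]; apply: (le_trans (tauB i)).
    rewrite mulrC ler_wpM2r// lef_pV2 ?posrE ?ltr0n// ler_nat; exact: leqW.
  rewrite -mulr_sumr ler_wpM2l//.
  apply: (@le_trans _ _ (\sum_(n <= i < l) B i)).
    by rewrite (big_cat_nat (n := k) (m := n) (p := l))//= lerDl sumr_ge0.
  have -> : \sum_(n <= i < l) B i = s l - s n + \sum_(n <= i < l) b i.
    rewrite /s -!(big_mkord xpredT (fun i => B i - b i)).
    rewrite (big_cat_nat (n := n) (m := 0%N) (p := l))//=; last exact: leq_trans kl.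
    rewrite [X in X - _ + _]addrC addrK -big_split/=.
    by apply: eq_bigr => i _; rewrite subrK.
  apply: lerD.
    by apply: lerD; [exact: ler_norm|rewrite -normrN; exact: ler_norm].
  apply: (@le_trans _ _ (\sum_(n <= i < l) C)); first exact: ler_sum.
  by rewrite sumr_const_nat mulr_natr.
apply/cvgrPdist_le => e e0.
have [k k0 Hk] := Gk (e / 2) ltac:(by rewrite divr_gt0).
(* A window of relative length 1/D moves tau by at most C/D, one half of the allowed e/2. The other
   half goes to the fluctuations: e/12 at [n], and twice e/12 at [l <= 2 n]. *)
have [D D0 CD] : exists2 D : nat, (0 < D)%N & C / D%:R <= e / 4.
  exists (Num.trunc (`|C| / (e / 4))).+1 => //.
  rewrite ler_pdivrMr ?ltr0n// -ler_pdivrMl ?divr_gt0// mulrC.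
  apply: (@le_trans _ _ (`|C| / (e / 4))).
    by rewrite ler_wpM2r ?ler_norm// invr_ge0 divr_ge0// ltW.
  by rewrite ltW// truncnS_gt.
have eta0 : 0 < e / 12 by rewrite divr_gt0.
move/cvgrPdist_le : Scvg => /(_ _ eta0)[N1 _ HN1].
(* One quarter of the window's contribution k/(4D): two such errors, at [n] and at [l], still
   contradict it. *)
have kD : 0 < k / (16 * D%:R) by rewrite divr_gt0// mulr_gt0// ltr0n.
move/cvgrPdist_le : ucvg => /(_ _ kD)[N2 _ HN2].
near=> n.
have nN1 : (N1 <= n)%N by near: n; exact: nbhs_infty_ge.
have nN2 : (N2 <= n)%N by near: n; exact: nbhs_infty_ge.
have nD : (D <= n)%N by near: n; exact: nbhs_infty_ge.
have n0 : (0 < n)%N by apply: leq_trans nD.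
have n0' : 0 < n%:R :> R by rewrite ltr0n.
have D0' : 0 < D%:R :> R by rewrite ltr0n.
rewrite distrC leNgt; apply/negP => en.
set l := (n + n %/ D)%N.
have nl : (n <= l)%N by rewrite leq_addr.
have l2n : l%:R <= 2 * n%:R :> R.
  by rewrite -natrM ler_nat mul2n -addnn leq_add2l leq_div.
have sbd c : (N1 <= c)%N -> `|s c| <= e / 12 * c%:R.
  move=> Nc; have := HN1 _ Nc; rewrite /= sub0r normrN normrM.
  case: (posnP c) => [-> _|c0]; first by rewrite /s big_ord0 normr0 mulr0.
  by rewrite gtr0_norm ?invr_gt0 ?ltr0n// ler_pdivrMl ?ltr0n// mulrC.
have sn := sbd _ nN1; have sl := sbd _ (leq_trans nN1 nl).
have ln : (l - n)%:R <= n%:R / D%:R :> R.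
  by rewrite /l addKn ler_pdivlMr// -natrM ler_nat leq_trunc_div.
have osc c : (n <= c)%N -> (c <= l)%N -> `|tau c - tau n| <= e / 2.
  move=> nc cl; apply: (le_trans (tausub _ _ _ n0 nc cl)).
  rewrite ler_pdivrMl//.
  have : C * (l - n)%:R <= e / 4 * n%:R.
    have [C0|/ltW C0] := leP 0 C.
      apply: (le_trans (ler_wpM2l C0 ln)).
      by rewrite mulrCA mulrC ler_wpM2r// ltW.
    apply: (@le_trans _ _ 0); first by rewrite mulr_le0_ge0.
    by rewrite mulr_ge0// ltW// divr_gt0.
  nra.
have Gbig c : (n <= c)%N -> (c <= l)%N -> k <= G (tau c).
  move=> nc cl; apply: Hk.
  have := osc _ nc cl; have := ler_normD (tau n - tau c) (tau c - theta).
  rewrite addrA subrK (distrC (tau n) (tau c)) => h1 h2; lra.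
have ubig : k / (4 * D%:R) <= u l - u n.
  rewrite usub//; apply: (@le_trans _ _ (\sum_(n <= i < l) k / (2 * n%:R))); last first.
    apply: ler_sum_nat => i /andP[ni il].
    apply: ler_pM; rewrite ?invr_ge0 ?mulr_ge0 ?(ltW k0)//.
      by apply: Gbig => //; exact: ltnW.
    rewrite lef_pV2 ?posrE ?mulr_gt0 ?ltr0n//.
    by apply: le_trans l2n; rewrite ler_nat.
  rewrite sumr_const_nat /l addKn -[leRHS]mulr_natr.
  rewrite -mulrA ler_wpM2l ?(ltW k0)//.
  rewrite [leRHS]mulrC ler_pdivlMr ?mulr_gt0// ler_pdivrMl ?mulr_gt0//.
  have : n%:R < (n %/ D)%:R * D%:R + D%:R :> R.
    rewrite -natrM -natrD ltr_nat; have := ltn_ceil n D0.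
    by rewrite mulSn addnC.
  (* As D <= n, rounding the quotient down costs at most a factor 2. *)
  have : 1 <= (n %/ D)%:R :> R by rewrite ler1n divn_gt0.
  nra.
have un := HN2 _ nN2; have ul := HN2 _ (leq_trans nN2 nl).
rewrite /= !ler_norml in un ul.
have : k / (4 * D%:R) = 4 * (k / (16 * D%:R)) by field; rewrite lt0r_neq0.
case/andP: un => ? ?; case/andP: ul => ? ?; lra.
Unshelve. all: by end_near. Qed.

End deterministic.

(** * A strong law for uncorrelated increments *)

Section real_integrals.
Set Implicit Arguments.
Unset Strict Implicit.
Context d (T : measurableType d) (R : realType) (P : probability T R).
Implicit Types f g : T -> R.

Local Notation intg f := (P.-integrable [set: T] (EFin \o f)).

Lemma intg_cst (c : R) : intg (fun _ : T => c).
Proof. exact: finite_measure_integrable_cst. Qed.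

Lemma intgD f g : intg f -> intg g -> intg (fun x => f x + g x).
Proof. by move=> hf hg; exact: (integrableD measurableT hf hg). Qed.

Lemma intgZ (c : R) f : intg f -> intg (fun x => c * f x).
Proof. by move=> hf; exact: (integrableZl measurableT c hf). Qed.

Lemma intg_le f g : measurable_fun [set: T] f -> intg g ->
  (forall x, `|f x| <= g x) -> intg f.
Proof.
move=> mf ig fg; apply: (le_integrable measurableT _ _ ig).
  exact/measurable_EFinP.
move=> x _ /=; rewrite lee_fin; apply: le_trans (fg x) _; exact: ler_norm.
Qed.

Lemma intg_bounded f (C : R) : measurable_fun [set: T] f ->
  (forall x, `|f x| <= C) -> intg f.
Proof. by move=> mf fC; exact: (intg_le mf (intg_cst C)). Qed.

Lemma Rintegral_EFin f : intg f ->
  ((\int[P]_x f x)%:E = \int[P]_x (f x)%:E)%E.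
Proof.
by move=> hf; rewrite fineK//; exact: integrable_fin_num.
Qed.

Lemma intg_sqr_mul f g :
  measurable_fun [set: T] f -> measurable_fun [set: T] g ->
  intg (fun x => f x ^+ 2) -> intg (fun x => g x ^+ 2) ->
  intg (fun x => f x * g x).
Proof.
move=> mf mg f2 g2; apply: (intg_le _ (intgD f2 g2)).
  exact: measurable_funM.
move=> x; rewrite ler_norml.
have := sqr_ge0 (f x - g x); have := sqr_ge0 (f x + g x).
rewrite !expr2 => h1 h2.
have := sqr_ge0 (f x); have := sqr_ge0 (g x); rewrite !expr2 => h3 h4.
by apply/andP; split; lra.
Qed.

Lemma intg_of_sqr f : measurable_fun [set: T] f -> intg (fun x => f x ^+ 2) -> intg f.
Proof.
move=> mf f2; apply: (intg_le mf (intgD (intg_cst 1) f2)) => x.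
have := sqr_ge0 (`|f x| - 1); have := real_normK (num_real (f x)).
have := normr_ge0 (f x); nra.
Qed.

Lemma RintegralP_cst (c : R) : \int[P]_x c = c.
Proof. by rewrite Rintegral_cst//= probability_setT /= mulr1. Qed.

(** By monotone convergence the sum of the series has integral at most [M], so it is finite almost
    everywhere and bounds the partial sums. *)
Lemma ae_bounded_partial_sums (Z : nat -> T -> R) (M : R) :
  (forall n, intg (Z n)) -> (forall n x, 0 <= Z n x) ->
  (forall N, \sum_(n < N) \int[P]_x Z n x <= M) ->
  {ae P, forall x, exists M', forall N, \sum_(n < N) Z n x <= M'}.
Proof.
move=> iZ Z0 ZM.
pose G x : \bar R := (\sum_(0 <= n <oo) (Z n x)%:E)%E.
have mZ n : measurable_fun [set: T] (EFin \o Z n) by exact/measurable_int/iZ.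
have intG : (\int[P]_x G x <= M%:E)%E.
  rewrite integral_nneseries//; last by move=> n x _; rewrite lee_fin.
  apply: lime_le.
    by apply: is_cvg_nneseries => n _ _; apply: integral_ge0 => x _; rewrite lee_fin.
  near=> N; rewrite (eq_bigr (fun n => (\int[P]_x Z n x)%:E)).
    by rewrite sumEFin lee_fin big_mkord.
  by move=> i _; rewrite Rintegral_EFin.
have iG : P.-integrable [set: T] G.
  apply/integrableP; split.
    by apply: ge0_emeasurable_sum => [n x _ _|n _]; [rewrite lee_fin|exact: mZ].
  rewrite (eq_integral G); first by apply: le_lt_trans intG _; rewrite ltry.
  by move=> x _; rewrite gee0_abs// nneseries_ge0// => n _ _; rewrite lee_fin.
have := integrable_ae measurableT iG.
apply: filterS => x /(_ I) Gx; exists (fine (G x)) => N.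
rewrite -lee_fin fineK// -sumEFin -(big_mkord xpredT (fun n => (Z n x)%:E)).
by apply: nneseries_lim_ge => n _ _; rewrite lee_fin.
Unshelve. all: by end_near. Qed.

(** Applied to squares, this takes the place of Chebyshev's inequality followed by Borel-Cantelli:
    the terms of an almost surely convergent series tend to 0. *)
Lemma ae_cvg0_of_sums (Z : nat -> T -> R) (M : R) :
  (forall n, intg (Z n)) -> (forall n x, 0 <= Z n x) ->
  (forall N, \sum_(n < N) \int[P]_x Z n x <= M) ->
  {ae P, forall x, Z n x @[n --> \oo] --> (0 : R)}.
Proof.
move=> iZ Z0 ZM; have := ae_bounded_partial_sums iZ Z0 ZM.
apply: filterS => x [M' HM'].
apply: (@cvg_series_cvg_0 _ _ (fun n => Z n x)).
apply: nondecreasing_is_cvgn.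
  apply/nondecreasing_seqP => n; rewrite /series/= big_nat_recr//= lerDl//.
by exists M' => _ [n _ <-]; rewrite /series/= big_mkord.
Qed.

Lemma sum_inv_sqr_le (N : nat) : \sum_(i < N) (i.+1%:R ^- 2 : R) <= 2.
Proof.
(* The telescoping bound 1/n^2 <= 2/n - 2/(n+1), valid for n >= 1, is what the induction can
   carry. *)
suff h : \sum_(i < N) (i.+1%:R ^- 2 : R) <= 2 - 2 * N.+1%:R^-1.
  by apply: (le_trans h); rewrite lerBlDr lerDl mulr_ge0.
elim: N => [|N IH]; first by rewrite big_ord0 invr1 mulr1 subrr.
rewrite big_ord_recr/=; apply: (le_trans (lerD IH (lexx _))).
set n : R := N.+1%:R.
have n0 : 1 <= n by rewrite ler1n.
have -> : N.+2%:R = n + 1 :> R by rewrite -(addn1 N.+1) natrD.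
have -> : 2 - 2 * n^-1 + n ^- 2 = 2 - 2 * (n + 1)^-1 + (1 - n) / (n ^+ 2 * (n + 1)).
  by field; apply/andP; split; lra.
by rewrite gerDl pmulr_lle0 ?invr_gt0 ?mulr_gt0 ?exprn_gt0//; lra.
Qed.

Section slln.
Variables (U m : nat -> T -> R) (C K alpha : R).
Hypotheses (alpha_ge0 : 0 <= alpha) (alpha_lt1 : alpha < 1).
Hypotheses (mU : forall n, measurable_fun [set: T] (U n)).
Hypotheses (mm : forall n, measurable_fun [set: T] (m n)).
Hypotheses (U0 : forall n x, 0 <= U n x) (mC : forall n x, 0 <= m n x <= C).
Hypotheses (U2 : forall n, intg (fun x => U n x ^+ 2)).
Hypotheses (U2K : forall n, \int[P]_x (U n x ^+ 2) <= K * n.+1%:R `^ alpha).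
Hypothesis Usm : forall n,
  \int[P]_x ((\sum_(i < n) (U i x - m i x)) * (U n x - m n x)) = 0.

Let S n x := \sum_(i < n) (U i x - m i x).
Let D n x := U n x - m n x.

Let mD n : measurable_fun [set: T] (D n).
Proof. exact: measurable_funB. Qed.

Let mS n : measurable_fun [set: T] (S n).
Proof. by apply: measurable_sum => i; exact: measurable_funB. Qed.

Let D2le n x : D n x ^+ 2 <= U n x ^+ 2 + C ^+ 2.
Proof.
have := U0 n x; have /andP[m0 mc] := mC n x; rewrite /D !expr2; nra.
Qed.

Let intD2 n : intg (fun x => D n x ^+ 2).
Proof.
apply: (intg_le _ (intgD (U2 n) (intg_cst (C ^+ 2)))).
  exact: measurable_funX.
by move=> x; rewrite ger0_norm ?sqr_ge0.
Qed.

Let ED2 n : \int[P]_x (D n x ^+ 2) <= (K + C ^+ 2) * n.+1%:R `^ alpha.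
Proof.
apply: (@le_trans _ _ (\int[P]_x (U n x ^+ 2 + C ^+ 2))).
  apply: le_Rintegral => //; exact: intgD (U2 n) (intg_cst _).
rewrite RintegralD//; last exact: intg_cst.
rewrite RintegralP_cst mulrDl lerD// ler_peMr ?sqr_ge0//.
by rewrite -[leLHS](powRr0 n.+1%:R) ler_powR// ler1n.
Qed.

(** [Usm] cancels the cross term in the square of [S n.+1], so second moments add up; each of the n
    increments contributes at most a constant times n^alpha. *)
Let ES2 n : intg (fun x => S n x ^+ 2) /\
  \int[P]_x (S n x ^+ 2) <= (K + C ^+ 2) * (n%:R * n%:R `^ alpha).
Proof.
have KC : 0 <= K + C ^+ 2.
  have := ED2 0%N; rewrite powR1 mulr1; apply: le_trans.
  by apply: Rintegral_ge0 => x _; exact: sqr_ge0.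
suff : intg (fun x => S n x ^+ 2) /\
  \int[P]_x (S n x ^+ 2) <= \sum_(i < n) (K + C ^+ 2) * i.+1%:R `^ alpha.
  move=> [? h]; split=> //; apply: (le_trans h).
  apply: (@le_trans _ _ (\sum_(i < n) (K + C ^+ 2) * n%:R `^ alpha)).
    apply: ler_sum => i _; rewrite ler_wpM2l//.
    by apply: ge0_ler_powR => //; rewrite ?nnegrE// ler_nat.
  by rewrite sumr_const card_ord -[leLHS]mulr_natr -mulrA [_ `^ _ * _]mulrC.
elim: n => [|n [iS IH]].
  have S0 x : S 0 x ^+ 2 = 0 by rewrite /S big_ord0 expr0n.
  rewrite (funext S0) big_ord0 RintegralP_cst lexx; split=> //; exact: intg_cst.
have SE : (fun x => S n.+1 x ^+ 2) =
    (fun x => S n x ^+ 2 + (2 * (S n x * D n x) + D n x ^+ 2)).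
  by apply/funext => x; rewrite /S big_ord_recr/= -/(S n x) -/(D n x); ring.
have iSD : intg (fun x => S n x * D n x) by exact: intg_sqr_mul.
have i2SD := intgZ 2 iSD.
split; first by rewrite SE; apply: intgD => //; exact: intgD.
rewrite SE RintegralD//; last exact: intgD.
rewrite RintegralD// RintegralZl// Usm mulr0 add0r big_ord_recr/=.
exact: lerD.
Qed.

(* Along n = k^q with q (1 - alpha) >= 2 the variances of S n / n are summable. *)
Lemma slln_uncorrelated :
  {ae P, forall x, (n%:R^-1 * \sum_(i < n) (U i x - m i x)) @[n --> \oo] --> (0 : R)}.
Proof.
pose q := (Num.trunc (2 / (1 - alpha))).+1.
have a1 : 0 < 1 - alpha by rewrite subr_gt0.
have q2 : 2 <= q%:R * (1 - alpha).
  by rewrite -ler_pdivrMr// ltW// truncnS_gt.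
have KC : 0 <= K + C ^+ 2.
  have := ED2 0%N; rewrite powR1 mulr1; apply: le_trans.
  by apply: Rintegral_ge0 => x _; exact: sqr_ge0.
pose Z k x := ((k.+1 ^ q)%:R^-1 * S (k.+1 ^ q)%N x) ^+ 2.
have iZ k : intg (Z k).
  rewrite /Z; under eq_fun do rewrite exprMn.
  by apply: intgZ; exact: (ES2 _).1.
(* The second moment of S n / n is of order n^(alpha - 1), which at n = (k+1)^q is (k+1)^(- q (1 -
   alpha)). *)
have EZ k : \int[P]_x Z k x <= (K + C ^+ 2) * k.+1%:R ^- 2.
  rewrite /Z; under eq_Rintegral do rewrite exprMn.
  rewrite RintegralZl//; last exact: (ES2 _).1.
  have [_ h] := ES2 (k.+1 ^ q)%N.
  have k0 : 0 < k.+1%:R :> R by [].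
  have kq0 : 0 < (k.+1 ^ q)%:R :> R by rewrite ltr0n expn_gt0.
  rewrite exprVn ler_pdivrMl ?exprn_gt0//; apply: (le_trans h).
  rewrite [leRHS]mulrCA ler_wpM2l// expr2 -mulrA ler_wpM2l ?(ltW kq0)//.
  rewrite ler_pdivlMr ?exprn_gt0// natrX -!powR_mulrn// -powRrM -powRD.
    rewrite ler_powR ?ler1n//; nra.
  by rewrite (gt_eqF k0) implybT.
have := ae_cvg0_of_sums iZ (fun k x => sqr_ge0 _) (M := (K + C ^+ 2) * 2) _.
have /[swap] /[apply] : forall N, \sum_(n < N) \int[P]_x Z n x <= (K + C ^+ 2) * 2.
  move=> N; apply: (@le_trans _ _ (\sum_(n < N) (K + C ^+ 2) * n.+1%:R ^- 2)).
    by apply: ler_sum => i _; exact: EZ.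
  by rewrite -mulr_sumr ler_wpM2l// sum_inv_sqr_le.
apply: filterS => x Zx.
apply: (@cesaro_of_subsequence _ (U ^~ x) (m ^~ x) C q) => //.
rewrite -(cvg_shiftS (fun k => (k ^ q)%:R^-1 * \sum_(i < k ^ q) (U i x - m i x))) /=.
apply/cvgrPdist_le => e e0.
have e2 : 0 < e ^+ 2 by rewrite exprn_gt0.
move/cvgrPdist_le : Zx => /(_ _ e2); apply: filterS => k.
rewrite !sub0r !normrN /Z normrX; rewrite ler_sqr ?nnegrE//; exact: ltW.
Qed.

End slln.

End real_integrals.

(** * Independence of the past and the present *)

Section independence.
Set Implicit Arguments.
Unset Strict Implicit.
Context d (T : measurableType d) (R : realType) (P : probability T R).

Local Notation intg f := (P.-integrable [set: T] (EFin \o f)).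

(** The product formula on rectangles identifies the law of the pair with the product of the two
    laws, and Fubini's theorem does the rest. Integrability for every frozen [z] makes the inner
    real integral agree with the Fubini section everywhere. *)
Lemma Rintegral_indep d1 d2 (U1 : measurableType d1) (U2 : measurableType d2)
    (Z : T -> U1) (W : T -> U2) (Phi : U1 * U2 -> R) :
  measurable_fun [set: T] Z -> measurable_fun [set: T] W ->
  measurable_fun [set: U1 * U2] Phi ->
  (forall A B, measurable A -> measurable B ->
     P (Z @^-1` A `&` W @^-1` B) = (P (Z @^-1` A) * P (W @^-1` B))%E) ->
  intg (fun x => Phi (Z x, W x)) ->
  (forall z, intg (fun x => Phi (z, W x))) ->
  intg (fun x => \int[P]_y Phi (Z x, W y)) /\
  \int[P]_x Phi (Z x, W x) = \int[P]_x \int[P]_y Phi (Z x, W y).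
Proof.
move=> mZ mW mPhi ZW iPhi iz.
pose Z' : {RV P >-> U1} := HB.pack Z (isMeasurableFun.Build _ _ _ _ Z mZ).
pose W' : {RV P >-> U2} := HB.pack W (isMeasurableFun.Build _ _ _ _ W mW).
pose V x := (Z x, W x).
have mV : measurable_fun [set: T] V by exact: measurable_fun_pair.
pose V' : {RV P >-> (U1 * U2)%type} := HB.pack V (isMeasurableFun.Build _ _ _ _ V mV).
pose m1 := distribution P Z'; pose m2 := distribution P W'.
have E A : measurable A -> (m1 \x m2)%E A = distribution P V' A.
  by apply: product_measure_unique => B C mB mC; exact: ZW.
have mE : measurable_fun [set: U1 * U2] (EFin \o Phi) by exact/measurable_EFinP.
have iP : (m1 \x m2)%E.-integrable [set: U1 * U2] (EFin \o Phi).
  apply/integrableP; split => //.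
  rewrite (@eq_measure_integral _ _ _ _ (distribution P V')); last first.
    by move=> A mA _; exact: E.
  have mA : measurable_fun [set: U1 * U2] (fun z => `|(EFin \o Phi) z|%E).
    exact: measurableT_comp.
  rewrite (@ge0_integral_distribution _ _ _ _ _ P V' _ mA)//=.
  by case/integrableP : iPhi.
have FE z : fubini_F m2 (EFin \o Phi) z = (\int[P]_y Phi (z, W y))%:E.
  rewrite /fubini_F /m2 (@integral_distribution _ _ _ _ _ P W' (fun y => (Phi (z, y))%:E))//=.
  - by rewrite Rintegral_EFin.
  - by apply/measurable_EFinP; exact: measurable_fun_pair2.
  - exact: iz.
have iF := integrable_fubini_F iP.
have mF := measurable_int _ iF.
have iF' : intg (fun x => \int[P]_y Phi (Z x, W y)).
  apply/integrableP; split.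
    rewrite (_ : _ \o _ = fubini_F m2 (EFin \o Phi) \o Z).
      exact: measurableT_comp.
    by apply/funext => x /=; rewrite FE.
  case/integrableP : iF => _; rewrite ge0_integral_distribution//=; last first.
    exact: measurableT_comp.
  by under eq_integral do rewrite /= FE.
split => //; apply: EFin_inj; rewrite !Rintegral_EFin//.
rewrite -[LHS](@integral_distribution _ _ _ _ _ P V' (EFin \o Phi))//.
rewrite -(@eq_measure_integral _ _ _ _ _ (m1 \x m2)%E); last first.
  by move=> A mA _; exact: E.
rewrite -integral12_prod_meas1// integral_distribution//=.
  by under eq_integral do rewrite /= FE.
rewrite (_ : _ \o _ = EFin \o (fun x => \int[P]_y Phi (Z x, W y)))//.
by apply/funext => x /=; rewrite FE.
Qed.

Section filtration.
Variable zeta : nat -> {RV P >-> R}.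
Hypothesis zeta_indep : forall n (B : nat -> set R), (forall i, measurable (B i)) ->
  P (\big[setI/setT]_(i < n) (zeta i @^-1` B i)) =
  (\prod_(i < n) P (zeta i @^-1` B i))%E.

(** The cylinders on [zeta 0], ..., [zeta n.-1]: they are stable under intersection, so measures can
    be compared on them. *)
Definition past_gen (n : nat) : set (set T) :=
  [set A | exists2 B : nat -> set R, forall i, measurable (B i) &
     A = \big[setI/setT]_(i < n) (zeta i @^-1` B i)].

(** The sample space with the smaller sigma-algebra, so that being known at time [n] is ordinary
    measurability on [past n]. *)
Definition past (n : nat) := g_sigma_algebraType (past_gen n).

Definition adapted d' (U : measurableType d') (n : nat) (Z : T -> U) :=
  measurable_fun [set: past n] (Z : past n -> U).

Let mzeta i (B : set R) : measurable B -> measurable (zeta i @^-1` B).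
Proof. by move=> mB; exact: measurable_funPTI. Qed.

Lemma past_gen_measurable n : past_gen n `<=` measurable.
Proof.
by move=> A [B mB ->]; apply: bigsetI_measurable => i _; exact: mzeta.
Qed.

Lemma past_measurable n (A : set T) : <<s past_gen n >> A -> measurable A.
Proof.
apply: smallest_sub; first exact: sigma_algebra_measurable.
exact: past_gen_measurable.
Qed.

Lemma adapted_measurable d' (U : measurableType d') n (Z : T -> U) :
  adapted n Z -> measurable_fun [set: T] Z.
Proof.
move=> aZ _ B mB; rewrite setTI; apply: (@past_measurable n).
by have := aZ measurableT B mB; rewrite setTI.
Qed.

Lemma past_genS n : past_gen n `<=` past_gen n.+1.
Proof.
move=> A [B mB ->]; exists (fun i => if (i < n)%N then B i else setT).
  by move=> i; case: ifP.
rewrite big_ord_recr/= ltnn preimage_setT setIT.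
by apply: eq_bigr => i _; rewrite ltn_ord.
Qed.

Lemma adaptedS d' (U : measurableType d') n (Z : T -> U) :
  adapted n Z -> adapted n.+1 Z.
Proof.
move=> aZ _ B mB; have := aZ measurableT B mB; rewrite !setTI.
by apply: sub_sigma_algebra2; exact: past_genS.
Qed.

Lemma adapted_le d' (U : measurableType d') n k (Z : T -> U) : (n <= k)%N ->
  adapted n Z -> adapted k Z.
Proof.
by move=> /subnK <- aZ; elim: (k - n)%N => // i IH; exact: adaptedS.
Qed.

Lemma adapted_zeta n : adapted n.+1 (zeta n).
Proof.
move=> _ B mB; rewrite setTI; apply: sub_sigma_algebra.
exists (fun i => if i == n then B else setT); first by move=> i; case: ifP.
rewrite big_ord_recr/= eqxx big1 ?setTI// => i _.
by rewrite ltn_eqF ?preimage_setT.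
Qed.

Lemma adapted_comp d1 d2 (U1 : measurableType d1) (U2 : measurableType d2) n
    (F : U1 -> U2) (Z : T -> U1) :
  measurable_fun [set: U1] F -> adapted n Z -> adapted n (fun x => F (Z x)).
Proof. by move=> mF aZ; exact: (measurableT_comp mF aZ). Qed.

Lemma adapted_cst d' (U : measurableType d') n (c : U) : adapted n (fun=> c).
Proof. exact: measurable_cst. Qed.

Lemma adapted_pair d1 d2 (U1 : measurableType d1) (U2 : measurableType d2) n
    (Z1 : T -> U1) (Z2 : T -> U2) :
  adapted n Z1 -> adapted n Z2 -> adapted n (fun x => (Z1 x, Z2 x)).
Proof. by move=> a1 a2; exact: (measurable_fun_pair a1 a2). Qed.

Lemma adaptedM n (Z1 Z2 : T -> R) :
  adapted n Z1 -> adapted n Z2 -> adapted n (fun x => Z1 x * Z2 x).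
Proof. by move=> a1 a2; exact: (measurable_funM a1 a2). Qed.

Lemma adaptedB n (Z1 Z2 : T -> R) :
  adapted n Z1 -> adapted n Z2 -> adapted n (fun x => Z1 x - Z2 x).
Proof. by move=> a1 a2; exact: (measurable_funB a1 a2). Qed.

Lemma adapted_sum n k (Z : 'I_k -> T -> R) :
  (forall i, adapted n (Z i)) -> adapted n (fun x => \sum_(i < k) Z i x).
Proof. by move=> aZ; exact: (@measurable_sum _ (past n) R setT 'I_k _ Z aZ). Qed.

(** With C the event on [zeta n], the finite measures P(A and C) and P(C) P(A), as functions of A,
    agree on the cylinders, hence on the sigma-algebra that they generate. *)
Lemma past_indep n (A : set T) (B : set R) : <<s past_gen n >> A -> measurable B ->
  P (A `&` zeta n @^-1` B) = (P A * P (zeta n @^-1` B))%E.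
Proof.
move=> sA mB; have mC := mzeta n mB; set C := zeta n @^-1` B in mC *.
pose r : {nonneg R} := NngNum (fine_ge0 (measure_ge0 P C)).
have rE : r%:num%:E = P C by rewrite /= fineK// fin_num_measure.
have gT : past_gen n setT.
  by exists (fun=> setT) => //; rewrite big1// => i _; rewrite preimage_setT.
rewrite -[LHS]/(mrestr P mC A) [RHS]muleC -rE -[RHS]/(mscale r P A).
apply: (@g_sigma_algebra_measure_unique _ _ _ (past_gen n) _ (fun=> setT)) => //.
- exact: past_gen_measurable.
- by apply/seteqP; split => // x _; exists 0%N.
- move=> _ _ [B1 mB1 ->] [B2 mB2 ->]; exists (fun i => B1 i `&` B2 i).
    by move=> i; exact: measurableI.
  by rewrite -big_split/=; apply: eq_bigr => i _; rewrite preimage_setI.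
- move=> _ [B1 mB1 ->]; rewrite /mrestr/= /mscale rE.
  (* Placing [B] at position [n] turns the intersection into a cylinder on n+1 variables. *)
  pose B' i := if i == n then B else B1 i.
  have mB' i : measurable (B' i) by rewrite /B'; case: ifP.
  have B'E (i : 'I_n) : B' i = B1 i by rewrite /B' ltn_eqF.
  have := zeta_indep n.+1 mB'; rewrite !big_ord_recr/= {2 4}/B' eqxx -/C.
  under eq_bigr do rewrite B'E.
  under [in RHS]eq_bigr do rewrite B'E.
  by move=> h; apply: (etrans h); rewrite -zeta_indep// muleC.
- move=> k; rewrite /mrestr/=; apply: le_lt_trans (probability_le1 P _) (ltry _).
  exact: measurableI.
Qed.

(** The freezing lemma for conditional expectations, stated without them: what is known at time [n]
    is held fixed while [zeta n] is integrated out. *)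
Lemma adapted_Rintegral d' (U : measurableType d') n (Z : T -> U) (Phi : U * R -> R) :
  adapted n Z -> measurable_fun [set: U * R] Phi ->
  intg (fun x => Phi (Z x, zeta n x)) ->
  (forall z, intg (fun x => Phi (z, zeta n x))) ->
  intg (fun x => \int[P]_y Phi (Z x, zeta n y)) /\
  \int[P]_x Phi (Z x, zeta n x) = \int[P]_x \int[P]_y Phi (Z x, zeta n y).
Proof.
move=> aZ mPhi; apply: Rintegral_indep => //; first exact: adapted_measurable aZ.
move=> A B mA mB; apply: past_indep => //.
by have := aZ measurableT A mA; rewrite setTI.
Qed.

Lemma adapted_RintegralM n (Z : T -> R) (eta : R -> R) :
  adapted n Z -> measurable_fun [set: R] eta ->
  intg (fun x => Z x * eta (zeta n x)) -> intg (fun x => eta (zeta n x)) ->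
  intg Z ->
  \int[P]_x (Z x * eta (zeta n x)) = (\int[P]_x Z x) * \int[P]_x eta (zeta n x).
Proof.
move=> aZ meta iZe ie iZ.
have mPhi : measurable_fun [set: R * R] (fun p : R * R => p.1 * eta p.2).
  by apply: measurable_funM => //; exact: measurableT_comp.
have [_ ->] := adapted_Rintegral aZ mPhi iZe (fun z => intgZ z ie).
transitivity (\int[P]_x (Z x * \int[P]_y eta (zeta n y))).
  by apply: eq_Rintegral => x _ /=; rewrite RintegralZl.
by rewrite RintegralZr.
Qed.

End filtration.

End independence.

(** * Strong law for adapted weights multiplied by noise *)

Section product_slln.
Set Implicit Arguments.
Unset Strict Implicit.
Context d (T : measurableType d) (R : realType) (P : probability T R).

Local Notation intg f := (P.-integrable [set: T] (EFin \o f)).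

(** The measurability half of Tonelli's theorem; it makes the conditional mean of a weight, a
    function of tau, adapted. *)
Lemma measurable_Rintegral_section d1 d2 (U1 : measurableType d1)
    (U2 : measurableType d2) (W : T -> U2) (Phi : U1 * U2 -> R) :
  measurable_fun [set: T] W -> measurable_fun [set: U1 * U2] Phi ->
  (forall z, 0 <= Phi z) -> (forall z, intg (fun x => Phi (z, W x))) ->
  measurable_fun [set: U1] (fun z => \int[P]_x Phi (z, W x)).
Proof.
move=> mW mPhi Phi0 iPhi; apply/measurable_EFinP.
pose W' : {RV P >-> U2} := HB.pack W (isMeasurableFun.Build _ _ _ _ W mW).
have mE : measurable_fun [set: U1 * U2] (EFin \o Phi) by exact/measurable_EFinP.
rewrite (_ : _ \o _ = fubini_F (distribution P W') (EFin \o Phi)).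
  by apply: measurable_fun_fubini_tonelli_F => // z; rewrite lee_fin.
apply/funext => z /=; rewrite Rintegral_EFin// /fubini_F.
rewrite (@ge0_integral_distribution _ _ _ _ _ P W' (fun y => (Phi (z, y))%:E))//=.
  by apply/measurable_EFinP; exact: measurable_fun_pair2.
by move=> y; rewrite lee_fin.
Qed.

Lemma intg_sqrD (f g : T -> R) : measurable_fun [set: T] f -> measurable_fun [set: T] g ->
  intg (fun x => f x ^+ 2) -> intg (fun x => g x ^+ 2) ->
  intg (fun x => (f x + g x) ^+ 2).
Proof.
move=> mf mg f2 g2; apply: (intg_le _ (intgD (intgZ 2 f2) (intgZ 2 g2))).
  by apply: measurable_funX; exact: measurable_funD.
move=> x; rewrite ger0_norm ?sqr_ge0//.
have := sqr_ge0 (f x - g x); nra.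
Qed.

Variable zeta : nat -> {RV P >-> R}.
Hypothesis zeta_indep : forall n (B : nat -> set R), (forall i, measurable (B i)) ->
  P (\big[setI/setT]_(i < n) (zeta i @^-1` B i)) =
  (\prod_(i < n) P (zeta i @^-1` B i))%E.

(* One independent sequence interleaves the observation times and the noise, so
   that the present pair (X_i, e_i) is met in two steps: X_i is independent of
   [past zeta i.*2], and e_i of [past zeta i.*2.+1], to which X_i belongs. *)
Let X i : {RV P >-> R} := zeta i.*2.
Let e i : {RV P >-> R} := zeta i.*2.+1.

Section general_noise.
Unset Implicit Arguments.
Variables (tau : nat -> T -> R) (psi : nat -> R -> R -> R) (eta : R -> R).
Variables (C c N alpha : R).
Hypotheses (alpha_ge0 : 0 <= alpha) (alpha_lt1 : alpha < 1).
Hypothesis tau_adapted : forall i, adapted zeta i.*2 (tau i).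
Hypothesis psi_measurable : forall i, measurable_fun [set: R * R] (fun p => psi i p.1 p.2).
Hypothesis psi_ge0 : forall i t x, 0 <= psi i t x.
Hypothesis psi_le : forall i t x, psi i t x <= c * i.+1%:R `^ alpha.
Hypothesis psi_mean : forall i t, \int[P]_x psi i t (X i x) <= C.
Hypothesis eta_measurable : measurable_fun [set: R] eta.
Hypothesis eta_ge0 : forall y, 0 <= eta y.
Hypothesis eta_sqr : forall i, intg (fun x => eta (e i x) ^+ 2).
Hypothesis eta_var : forall i, \int[P]_x (eta (e i x) ^+ 2) <= N.

Let Psi i t := \int[P]_x psi i t (X i x).
Let Eeta i := \int[P]_x eta (e i x).
Let U i x := psi i (tau i x) (X i x) * eta (e i x).
Let m i x := Psi i (tau i x) * Eeta i.
Let S n x := \sum_(i < n) (U i x - m i x).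

Let aX i : adapted zeta i.*2.+1 (X i). Proof. exact: adapted_zeta. Qed.
Let ae i : adapted zeta i.*2.+2 (e i). Proof. exact: adapted_zeta. Qed.

Let apsi i : adapted zeta i.*2.+1 (fun x => psi i (tau i x) (X i x)).
Proof.
apply: (adapted_comp (psi_measurable i) (Z := fun x => (tau i x, X i x))).
by apply: adapted_pair => //; exact: adaptedS.
Qed.

Let aeta i : adapted zeta i.*2.+2 (fun x => eta (e i x)).
Proof. exact: adapted_comp. Qed.

Let aU i : adapted zeta i.*2.+2 (U i).
Proof. by apply: adaptedM; [exact: adaptedS|exact: aeta]. Qed.

Let mpsit i t : measurable_fun [set: R] (psi i t).
Proof. exact: (measurable_fun_pair2 _ (psi_measurable i)). Qed.

Let ipsi i t : intg (fun x => psi i t (X i x)).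
Proof.
apply: (@intg_bounded _ _ _ _ _ (c * i.+1%:R `^ alpha)).
  exact: measurableT_comp.
by move=> x; rewrite ger0_norm.
Qed.

Let mPsi i : measurable_fun [set: R] (Psi i).
Proof.
apply: (@measurable_Rintegral_section _ _ _ _ (X i) (fun p => psi i p.1 p.2)) => //.
exact: ipsi.
Qed.

Let am i : adapted zeta i.*2 (m i).
Proof.
by apply: adaptedM; [exact: adapted_comp|exact: adapted_cst].
Qed.

Let aS n : adapted zeta n.*2 (S n).
Proof.
apply: adapted_sum => i; apply: adaptedB.
  apply: (adapted_le _ (aU i)); rewrite -doubleS leq_double; exact: ltn_ord.
by apply: (adapted_le _ (am i)); rewrite leq_double ltnW.
Qed.

Let ieta i : intg (fun x => eta (e i x)).
Proof. by apply: intg_of_sqr; [exact: adapted_measurable (aeta i)|exact: eta_sqr]. Qed.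

Let Eeta_ge0 i : 0 <= Eeta i. Proof. by apply: Rintegral_ge0. Qed.

Let Eeta_le i : Eeta i <= 1 + N.
Proof.
apply: (@le_trans _ _ (\int[P]_x (1 + eta (e i x) ^+ 2))).
  apply: le_Rintegral => //; first exact: intgD (intg_cst _ _) (eta_sqr i).
  move=> x _; have := sqr_ge0 (eta (e i x) - 1); have := eta_ge0 (e i x); nra.
by rewrite RintegralD// ?RintegralP_cst ?lerD2l//; exact: intg_cst.
Qed.

Let Psi_ge0 i t : 0 <= Psi i t. Proof. by apply: Rintegral_ge0. Qed.

Let C_ge0 : 0 <= C. Proof. exact: le_trans (Psi_ge0 0 0) (psi_mean 0 0). Qed.

Let N_ge0 : 0 <= N.
Proof. by apply: le_trans (eta_var 0); apply: Rintegral_ge0 => x _; exact: sqr_ge0. Qed.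

Let c_ge0 i : 0 <= c * i.+1%:R `^ alpha.
Proof. exact: le_trans (psi_ge0 i 0 0) (psi_le i 0 0). Qed.

Let m_bnd i x : 0 <= m i x <= C * (1 + N).
Proof.
apply/andP; split; first exact: mulr_ge0 (Psi_ge0 _ _) (Eeta_ge0 _).
exact: ler_pM (Psi_ge0 _ _) (Eeta_ge0 _) (psi_mean _ _) (Eeta_le _).
Qed.

Let U2 i : intg (fun x => U i x ^+ 2).
Proof.
apply: (intg_le _ (intgZ ((c * i.+1%:R `^ alpha) ^+ 2) (eta_sqr i))).
  exact: measurable_funX (adapted_measurable (aU i)).
move=> x; rewrite ger0_norm ?sqr_ge0// /U exprMn ler_wpM2r ?sqr_ge0//.
by rewrite ler_sqr ?nnegrE.
Qed.

Let ipsitau i : intg (fun x => psi i (tau i x) (X i x)).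
Proof.
apply: (@intg_bounded _ _ _ _ _ (c * i.+1%:R `^ alpha)).
  exact: adapted_measurable (apsi i).
by move=> x; rewrite ger0_norm.
Qed.

Let Epsi i : \int[P]_x psi i (tau i x) (X i x) <= C.
Proof.
have [ip ->] := adapted_Rintegral zeta_indep (tau_adapted i) (psi_measurable i)
  (ipsitau i) (ipsi i).
apply: (@le_trans _ _ (\int[P]_x C)); last by rewrite RintegralP_cst.
by apply: le_Rintegral => //; first [exact: intg_cst|move=> x _; exact: psi_mean].
Qed.

(** One factor [psi] is bounded by c (i+1)^alpha, while the other contributes its mean, at most [C].
    Bounding both by their maximum would give the exponent 2 alpha, which can exceed 1. *)
Let EU2 i : \int[P]_x (U i x ^+ 2) <= c * C * N * i.+1%:R `^ alpha.
Proof.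
pose V x := c * i.+1%:R `^ alpha * psi i (tau i x) (X i x).
have aV : adapted zeta i.*2.+1 V.
  by apply: adaptedM; [exact: adapted_cst|exact: apsi].
have iV : intg V by exact: intgZ.
have me2 : measurable_fun [set: R] (fun y => eta y ^+ 2) by exact: measurable_funX.
have iVe : intg (fun x => V x * eta (e i x) ^+ 2).
  apply: (intg_le _ (intgZ ((c * i.+1%:R `^ alpha) ^+ 2) (eta_sqr i))).
    apply: measurable_funM; first exact: adapted_measurable aV.
    exact: (measurableT_comp me2).
  move=> x; rewrite ger0_norm; last first.
    by apply: mulr_ge0; [exact: mulr_ge0 (c_ge0 i) (psi_ge0 _ _ _)|exact: sqr_ge0].
  rewrite ler_wpM2r ?sqr_ge0//.
  by rewrite /V [leRHS]expr2 ler_wpM2l.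
have /= EV := adapted_RintegralM zeta_indep aV me2 iVe (eta_sqr i) iV.
apply: (@le_trans _ _ (\int[P]_x (V x * eta (e i x) ^+ 2))).
  apply: le_Rintegral => // x _; rewrite /U exprMn ler_wpM2r ?sqr_ge0//.
  by rewrite expr2 /V ler_wpM2r.
rewrite EV RintegralZl//.
have -> : c * C * N * i.+1%:R `^ alpha = (c * i.+1%:R `^ alpha * C) * N by ring.
apply: ler_pM => //.
- by rewrite mulr_ge0// Rintegral_ge0.
- by apply: Rintegral_ge0 => x _; exact: sqr_ge0.
- by rewrite ler_wpM2l.
- exact: eta_var.
Qed.

Let S2 n : intg (fun x => S n x ^+ 2).
Proof.
rewrite /S; elim: n => [|n IH].
  by under eq_fun do rewrite big_ord0 expr0n; exact: intg_cst.
under eq_fun do rewrite big_ord_recr/= addrA.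
have mUn := adapted_measurable (aU n); have mmn := adapted_measurable (am n).
have mSn := adapted_measurable (aS n).
apply: intg_sqrD.
- exact: measurable_funD.
- exact: measurableT_comp.
- exact: intg_sqrD.
- under eq_fun do rewrite sqrrN.
  apply: (@intg_bounded _ _ _ _ _ ((C * (1 + N)) ^+ 2)); first exact: measurable_funX.
  move=> x; rewrite ger0_norm ?sqr_ge0//; have /andP[m0 mc] := m_bnd n x.
  by rewrite ler_sqr ?nnegrE//; exact: le_trans mc.
Qed.

(** Two successive freezings: [e n] is integrated out against everything known once [X n] is
    observed, then [X n] against [S n] and [tau n]. What remains is the integral of [S n] times
    [m n]. *)
Let USm n : \int[P]_x (S n x * (U n x - m n x)) = 0.
Proof.
have mUn := adapted_measurable (aU n); have mmn := adapted_measurable (am n).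
have mSn := adapted_measurable (aS n).
have iS : intg (S n) by exact: intg_of_sqr.
have iSU : intg (fun x => S n x * U n x) by exact: intg_sqr_mul.
have iSpsi : intg (fun x => S n x * psi n (tau n x) (X n x)).
  apply: intg_sqr_mul => //; first exact: adapted_measurable (apsi n).
  apply: (@intg_bounded _ _ _ _ _ ((c * n.+1%:R `^ alpha) ^+ 2)).
    by apply: measurable_funX; exact: adapted_measurable (apsi n).
  by move=> x; rewrite ger0_norm ?sqr_ge0// ler_sqr ?nnegrE.
have aSpsi : adapted zeta n.*2.+1 (fun x => S n x * psi n (tau n x) (X n x)).
  by apply: adaptedM; [exact: adaptedS|exact: apsi].
have iSm : intg (fun x => S n x * m n x).
  apply: intg_sqr_mul => //.
  apply: (@intg_bounded _ _ _ _ _ ((C * (1 + N)) ^+ 2)); first exact: measurable_funX.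
  move=> x; rewrite ger0_norm ?sqr_ge0//; have /andP[m0 mc] := m_bnd n x.
  by rewrite ler_sqr ?nnegrE//; exact: le_trans mc.
have E1 : \int[P]_x (S n x * U n x) =
    (\int[P]_x (S n x * psi n (tau n x) (X n x))) * Eeta n.
  rewrite -(adapted_RintegralM zeta_indep aSpsi eta_measurable)//.
    by apply: eq_Rintegral => x _; rewrite /U mulrA.
    by under eq_fun do rewrite -mulrA.
  exact: ieta.
(* [S n] and [tau n] are grouped into one variable of the past, so that only [X n] is integrated. *)
pose Phi (p : (R * R) * R) := p.1.1 * psi n p.1.2 p.2.
have mPhi : measurable_fun [set: (R * R) * R] Phi.
  apply: measurable_funM; first by apply: measurableT_comp => //.
  have mq : measurable_fun [set: (R * R) * R] (fun p : (R * R) * R => (p.1.2, p.2)).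
    by apply: measurable_fun_pair => //; apply: measurableT_comp.
  exact: (measurableT_comp (psi_measurable n) mq).
have aZ : adapted zeta n.*2 (fun x => (S n x, tau n x)) by exact: adapted_pair.
have [iE E2] := adapted_Rintegral zeta_indep aZ mPhi iSpsi (fun z => intgZ z.1 (ipsi n z.2)).
have E3 x : \int[P]_y Phi ((S n x, tau n x), zeta n.*2 y) = S n x * Psi n (tau n x).
  by rewrite /Phi/= RintegralZl//; exact: ipsi.
transitivity (\int[P]_x (S n x * U n x - S n x * m n x)).
  by apply: eq_Rintegral => x _; rewrite mulrBr.
rewrite RintegralB// E1 (_ : \int[P]_x (S n x * m n x) =
  (\int[P]_x (S n x * Psi n (tau n x))) * Eeta n); last first.
  under eq_Rintegral do rewrite /m mulrA.
  by rewrite RintegralZr//; move: iE; under eq_fun do rewrite E3.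
rewrite (_ : \int[P]_x _ = \int[P]_x (S n x * Psi n (tau n x))) ?subrr//.
by rewrite [LHS]E2; apply: eq_Rintegral => x _; exact: E3.
Qed.

Lemma slln_product :
  {ae P, forall x, (n%:R^-1 * \sum_(i < n)
    (psi i (tau i x) (X i x) * eta (e i x) - Psi i (tau i x) * Eeta i)) @[n --> \oo]
    --> (0 : R)}.
Proof.
apply: (slln_uncorrelated alpha_ge0 alpha_lt1 _ _ _ m_bnd U2 EU2 USm).
- by move=> n; exact: adapted_measurable (aU n).
- by move=> n; exact: adapted_measurable (am n).
- by move=> n x; exact: mulr_ge0 (psi_ge0 _ _ _) (eta_ge0 _).
Qed.

End general_noise.
End product_slln.
Arguments slln_product {d T R P zeta} _ {tau psi eta C c N alpha}.

(** * Strong laws and stochastic approximation *)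

Section strong_laws.
Context d (T : measurableType d) (R : realType) (P : probability T R).

Local Notation intg f := (P.-integrable [set: T] (EFin \o f)).

Variable zeta : nat -> {RV P >-> R}.
Hypothesis zeta_indep : forall n (B : nat -> set R), (forall i, measurable (B i)) ->
  P (\big[setI/setT]_(i < n) (zeta i @^-1` B i)) =
  (\prod_(i < n) P (zeta i @^-1` B i))%E.

Let X i : {RV P >-> R} := zeta i.*2.
Let e i : {RV P >-> R} := zeta i.*2.+1.

Let adapted0 i : adapted zeta i.*2 (fun _ : T => 0 : R).
Proof. exact: adapted_cst. Qed.

Variable N : R.
Hypothesis e_sqr : forall i, intg (fun x => e i x ^+ 2).
Hypothesis e_var : forall i, \int[P]_x (e i x ^+ 2) <= N.
Hypothesis e_mean : forall i, \int[P]_x e i x = 0.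

Section weighted.
Variables (tau : nat -> T -> R) (psi : nat -> R -> R -> R) (C c alpha : R).
Hypotheses (alpha_ge0 : 0 <= alpha) (alpha_lt1 : alpha < 1).
Hypothesis tau_adapted : forall i, adapted zeta i.*2 (tau i).
Hypothesis psi_measurable : forall i, measurable_fun [set: R * R] (fun p => psi i p.1 p.2).
Hypothesis psi_ge0 : forall i t x, 0 <= psi i t x.
Hypothesis psi_le : forall i t x, psi i t x <= c * i.+1%:R `^ alpha.
Hypothesis psi_mean : forall i t, \int[P]_x psi i t (X i x) <= C.

Lemma slln_weights :
  {ae P, forall x, (n%:R^-1 * \sum_(i < n)
    (psi i (tau i x) (X i x) - \int[P]_y psi i (tau i x) (X i y))) @[n --> \oo]
    --> (0 : R)}.
Proof.
have /= := @slln_product _ _ _ _ _ zeta_indep tau psi (fun=> 1) C c 1 alpha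
  alpha_ge0 alpha_lt1 tau_adapted psi_measurable psi_ge0 psi_le psi_mean.
move=> h; have {h} := h (measurable_cst _) (fun=> ler01) _ _.
rewrite expr1n RintegralP_cst => h.
have := h (fun=> intg_cst _ _) (fun=> lexx _).
apply: filterS => x; apply: cvg_trans; apply: near_eq_cvg; near=> n.
by congr (_ * _); apply: eq_bigr => i _; rewrite !mulr1.
Unshelve. all: by end_near. Qed.

(** The positive and the negative part of centred noise have the same mean, so the compensators of
    the two strong laws cancel in their difference. *)
Lemma slln_weighted_noise :
  {ae P, forall x, (n%:R^-1 * \sum_(i < n)
    psi i (tau i x) (X i x) * e i x) @[n --> \oo] --> (0 : R)}.
Proof.
pose pos (y : R) := Num.max y 0; pose neg (y : R) := Num.max (- y) 0.
have mpos : measurable_fun [set: R] pos by exact: measurable_maxr.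
have mneg : measurable_fun [set: R] neg by apply: measurable_maxr => //.
have pos0 y : 0 <= pos y by rewrite le_max lexx orbT.
have neg0 y : 0 <= neg y by rewrite le_max lexx orbT.
have pos2 y : pos y ^+ 2 <= y ^+ 2.
  rewrite -[leRHS]real_normK ?num_real// ler_sqr ?nnegrE//.
  by rewrite /pos ge_max normr_ge0 ler_norm.
have neg2 y : neg y ^+ 2 <= y ^+ 2.
  rewrite -[leRHS]real_normK ?num_real// ler_sqr ?nnegrE//.
  by rewrite /neg ge_max normr_ge0 -normrN ler_norm.
have posneg y : pos y - neg y = y.
  by rewrite /pos /neg; case: leP => h1; case: leP => h2; lra.
have ipart (eta : R -> R) : measurable_fun [set: R] eta ->
    (forall y, eta y ^+ 2 <= y ^+ 2) ->
    (forall i, intg (fun x => eta (e i x) ^+ 2)) /\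
    (forall i, \int[P]_x (eta (e i x) ^+ 2) <= N).
  move=> meta eta2.
  have ie i : intg (fun x => eta (e i x) ^+ 2).
    apply: (intg_le _ (e_sqr i)).
      by apply: measurable_funX; exact: measurableT_comp.
    by move=> x; rewrite ger0_norm ?sqr_ge0.
  by split=> // i; apply: le_trans (e_var i); apply: le_Rintegral.
have [ip Ep] := ipart _ mpos pos2; have [im Em] := ipart _ mneg neg2.
have iint (eta : R -> R) i : measurable_fun [set: R] eta ->
    intg (fun x => eta (e i x) ^+ 2) -> intg (fun x => eta (e i x)).
  by move=> meta; apply: intg_of_sqr; exact: measurableT_comp.
have EE i : \int[P]_x pos (e i x) = \int[P]_x neg (e i x).
  apply/eqP; rewrite -subr_eq0 -RintegralB//; [|exact: iint|exact: iint].
  apply/eqP; rewrite -[RHS](e_mean i); apply: eq_Rintegral => x _.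
  exact: posneg.
have := slln_product zeta_indep alpha_ge0 alpha_lt1 tau_adapted psi_measurable
  psi_ge0 psi_le psi_mean mneg neg0 im Em.
have := slln_product zeta_indep alpha_ge0 alpha_lt1 tau_adapted psi_measurable
  psi_ge0 psi_le psi_mean mpos pos0 ip Ep.
apply: filterS2 => x h1 h2.
apply: (cvg_near_eq (cvgB h1 h2)); first by rewrite subr0.
near=> n => /=.
rewrite -mulrBr -sumrB; congr (_ * _); apply: eq_bigr => i _.
rewrite -/(e i) EE -{3}(posneg (e i x)); ring.
Unshelve. all: by end_near. Qed.

End weighted.

Section bounded.
Variables (phi : R -> R) (M : R).
Hypothesis phi_measurable : measurable_fun [set: R] phi.
Hypothesis phi_le : forall x, `|phi x| <= M.

Let M_ge0 : 0 <= M. Proof. exact: le_trans (normr_ge0 _) (phi_le 0). Qed.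

Let iphi i : intg (fun x => phi (X i x)).
Proof. by apply: (@intg_bounded _ _ _ _ _ M) => //; exact: measurableT_comp. Qed.

(** The shift by [M] gives a nonnegative weight, bounded with exponent 0; it disappears from
    compensated sums. *)
Let psi (i : nat) (t x : R) := phi x + M.

Let psi0 i t x : 0 <= psi i t x.
Proof. by have := phi_le x; rewrite ler_norml /psi => /andP[? _]; lra. Qed.

Let psiM i t x : psi i t x <= 2 * M * i.+1%:R `^ 0.
Proof.
by rewrite powRr0; have := phi_le x; rewrite ler_norml /psi => /andP[_ ?]; lra.
Qed.

Let mpsi i : measurable_fun [set: R * R] (fun p => psi i p.1 p.2).
Proof. by apply: measurable_funD => //; exact: measurableT_comp. Qed.

Let Epsi i t : \int[P]_x psi i t (X i x) <= 2 * M.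
Proof.
apply: (@le_trans _ _ (\int[P]_x (2 * M))); last by rewrite RintegralP_cst.
apply: le_Rintegral => //; [exact: intgD (iphi i) (intg_cst _ _)|exact: intg_cst|].
by move=> x _; have := psiM i t (X i x); rewrite powRr0 mulr1.
Qed.

Lemma slln_bounded (c : R) : (forall i, \int[P]_x phi (X i x) = c) ->
  {ae P, forall x, (n%:R^-1 * \sum_(i < n) phi (X i x)) @[n --> \oo] --> c}.
Proof.
move=> Ec.
have := @slln_weights (fun _ _ => 0) psi (2 * M) (2 * M) 0 (lexx _) ltr01
  adapted0 mpsi psi0 psiM Epsi.
apply: filterS => x h.
apply: (cvg_near_eq (cvgD (cvg_cst c) h)); first by rewrite addr0.
near=> n => /=.
have n0 : n%:R != 0 :> R by rewrite pnatr_eq0 -lt0n; near: n; exact: nbhs_infty_gt.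
have -> : \sum_(i < n) (psi i 0 (X i x) - \int[P]_y psi i 0 (X i y)) =
    \sum_(i < n) phi (X i x) - n%:R * c.
  have -> : n%:R * c = \sum_(i < n) c by rewrite sumr_const card_ord mulr_natl.
  rewrite -sumrB; apply: eq_bigr => i _.
  rewrite /psi RintegralD//; last exact: intg_cst.
  by rewrite RintegralP_cst Ec; ring.
by rewrite mulrBr mulrA mulVf// mul1r addrC subrK.
Unshelve. all: by end_near. Qed.

Lemma slln_bounded_noise :
  {ae P, forall x, (n%:R^-1 * \sum_(i < n) phi (X i x) * e i x) @[n --> \oo] --> (0 : R)}.
Proof.
have h1 := @slln_weighted_noise (fun _ _ => 0) psi (2 * M) (2 * M) 0 (lexx _) ltr01
  adapted0 mpsi psi0 psiM Epsi.
(* With noise the shift by [M] leaves a term of its own, removed by the law for the constant weight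
   [M]. *)
have h2 := @slln_weighted_noise (fun _ _ => 0) (fun _ _ _ => M) M M 0 (lexx _) ltr01
  adapted0 (fun i => measurable_cst _) (fun _ _ _ => M_ge0) _ _.
have hM1 (i : nat) (t x : R) : M <= M * i.+1%:R `^ 0 by rewrite powRr0 mulr1.
have hM2 (i : nat) (t : R) : \int[P]_x M <= M by rewrite RintegralP_cst.
apply: filterS2 h1 (h2 hM1 hM2) => x k1 k2.
apply: (cvg_near_eq (cvgB k1 k2)); first by rewrite subr0.
near=> n => /=.
rewrite -mulrBr -sumrB; congr (_ * _); apply: eq_bigr => i _.
by rewrite /psi; ring.
Unshelve. all: by end_near. Qed.

End bounded.

Let ie i : intg (e i). Proof. exact: intg_of_sqr. Qed.

Let N_ge0 : 0 <= N.
Proof. by apply: le_trans (e_var 0); apply: Rintegral_ge0 => x _; exact: sqr_ge0. Qed.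

Let iabse i : intg (fun x => `|e i x|).
Proof.
apply: intg_of_sqr; first exact: measurableT_comp.
by under eq_fun do rewrite real_normK ?num_real//.
Qed.

Lemma mean_abs_noise_le i : \int[P]_x `|e i x| <= 1 + N.
Proof.
apply: (@le_trans _ _ (\int[P]_x (1 + e i x ^+ 2))).
  apply: le_Rintegral => //; first exact: intgD (intg_cst _ _) _.
  move=> x _; have := sqr_ge0 (`|e i x| - 1); have := normr_ge0 (e i x).
  have := real_normK (num_real (e i x)); nra.
by rewrite RintegralD// ?RintegralP_cst ?lerD2l//; exact: intg_cst.
Qed.

Lemma slln_abs_noise :
  {ae P, forall x, (n%:R^-1 * \sum_(i < n) (`|e i x| - \int[P]_y `|e i y|)) @[n --> \oo]
     --> (0 : R)}.
Proof.
have /= := @slln_product _ _ _ _ _ zeta_indep (fun _ _ => 0) (fun _ _ _ => 1)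
  (fun y => `|y|) 1 1 N 0 (lexx _) ltr01 adapted0
  (fun i => measurable_cst _) (fun _ _ _ => ler01) _ _ _ (fun y => normr_ge0 y) _ _.
move=> h; apply: filterS (h _ _ _ _ _).
- move=> x; apply: cvg_trans; apply: near_eq_cvg; near=> n.
  by congr (_ * _); apply: eq_bigr => i _; rewrite RintegralP_cst !mul1r.
- by move=> i t x; rewrite powRr0 mulr1.
- by move=> i t; rewrite RintegralP_cst.
- exact: normr_measurable.
- by move=> i; under eq_fun do rewrite real_normK ?num_real//; exact: e_sqr.
- by move=> i; under eq_Rintegral do rewrite real_normK ?num_real//; exact: e_var.
Unshelve. all: by end_near. Qed.

Section robbins_monro.
Variables (tau : nat -> T -> R) (k1 k2 : R -> R -> R) (G : R -> R) (theta B : R).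
Hypothesis tau_adapted : forall i, adapted zeta i.*2 (tau i).
Hypothesis tau_bnd : forall i x, `|tau i x| <= 1 / 4.
Hypothesis theta_bnd : `|theta| <= 1 / 4.
Hypothesis tauS : forall i x, tau i.+1 x = proj_quarter (tau i x + 1 / i.+1%:R *
  (k1 (tau i x) (X i x) + k2 (tau i x) (X i x) * e i x)).
Hypothesis k1_measurable : measurable_fun [set: R * R] (fun p => k1 p.1 p.2).
Hypothesis k2_measurable : measurable_fun [set: R * R] (fun p => k2 p.1 p.2).
Hypothesis k1_bnd : forall t x, `|k1 t x| <= B.
Hypothesis k2_bnd : forall t x, `|k2 t x| <= B.
Hypothesis G_measurable : measurable_fun [set: R] G.
Hypothesis G_ge0 : forall t, `|t| <= 1 / 4 -> 0 <= G t.
Hypothesis G_drift : forall i t, `|t| <= 1 / 4 ->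
  (t - theta) * \int[P]_x k1 t (X i x) <= - G t.
Hypothesis G_away : forall r, 0 < r -> exists2 k, 0 < k &
  forall t, `|t| <= 1 / 4 -> r <= `|t - theta| -> k <= G t.

Let H i x := k1 (tau i x) (X i x) + k2 (tau i x) (X i x) * e i x.
Let V i x := (tau i x - theta) ^+ 2.

(** Used twice: around theta, so that the projection never increases the squared error, and around
    [tau n] itself, to bound one step of the recursion. *)
Lemma proj_quarter_dist (s t : R) : `|t| <= 1 / 4 -> `|proj_quarter s - t| <= `|s - t|.
Proof.
rewrite /proj_quarter ler_norml => /andP[t1 t2]; rewrite ler_norml.
have n1 := ler_norm (s - t); have n2 : - (s - t) <= `|s - t| by rewrite -normrN ler_norm.
case: (leP (1 / 4) s) => s1; [case: (leP (- (1 / 4)) (1 / 4)) => s2|case: (leP (- (1 / 4)) s) => s2].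
all: by apply/andP; split; lra.
Qed.

Let VS i x : V i.+1 x <= V i x + 2 / i.+1%:R * ((tau i x - theta) * H i x) +
  i.+1%:R ^- 2 * (2 * B ^+ 2 * (1 + e i x ^+ 2)).
Proof.
have B0 : 0 <= B by exact: le_trans (normr_ge0 _) (k1_bnd 0 0).
have HB : H i x ^+ 2 <= 2 * B ^+ 2 * (1 + e i x ^+ 2).
  have a1 : k1 (tau i x) (X i x) ^+ 2 <= B ^+ 2.
    by rewrite -real_normK ?num_real// ler_sqr ?nnegrE.
  have a2 : k2 (tau i x) (X i x) ^+ 2 <= B ^+ 2.
    by rewrite -real_normK ?num_real// ler_sqr ?nnegrE.
  have a3 := ler_wpM2r (sqr_ge0 (e i x)) a2.
  rewrite /H; set u := k1 _ _ in a1 *; set v := k2 _ _ in a2 a3 *.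
  have := sqr_ge0 (u - v * e i x); rewrite -exprMn in a3; nra.
have -> : V i x + 2 / i.+1%:R * ((tau i x - theta) * H i x) +
  i.+1%:R ^- 2 * (2 * B ^+ 2 * (1 + e i x ^+ 2)) =
  (tau i x + 1 / i.+1%:R * H i x - theta) ^+ 2 +
  i.+1%:R ^- 2 * (2 * B ^+ 2 * (1 + e i x ^+ 2) - H i x ^+ 2).
  have : i.+1%:R != 0 :> R by rewrite pnatr_eq0.
  by rewrite /V; move: (i.+1%:R : R) => n n0; field.
apply: ler_wpDr; first by rewrite mulr_ge0// subr_ge0.
rewrite /V tauS -/(H i x) -[leLHS]real_normK ?num_real// -[leRHS]real_normK ?num_real//.
by rewrite ler_sqr ?nnegrE//; exact: proj_quarter_dist.
Qed.

Let mtau i : measurable_fun [set: T] (tau i).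
Proof. exact: adapted_measurable (tau_adapted i). Qed.

Let dtau_le t : `|t| <= 1 / 4 -> `|t - theta| <= 1.
Proof. by move=> ht; have := ler_normB t theta; have := theta_bnd; lra. Qed.

Let iV i : intg (V i).
Proof.
apply: (@intg_bounded _ _ _ _ _ 1).
  by apply: measurable_funX; exact: measurable_funB.
move=> x; rewrite normrX -[leRHS](expr1n _ 2) ler_sqr ?nnegrE//; exact: dtau_le.
Qed.

(** [G] is dominated by the drift, which is at most [B] since |t - theta| <= 1. *)
Let G_le t : `|t| <= 1 / 4 -> G t <= B.
Proof.
move=> ht; have := G_drift 0 _ ht; rewrite lerNr; move/le_trans; apply.
apply: (le_trans (ler_norm _)); rewrite normrN normrM -[leRHS]mul1r.
apply: ler_pM => //; first exact: dtau_le.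
have mk1 : measurable_fun [set: R] (k1 t) by exact: (measurable_fun_pair2 _ k1_measurable).
have ik : intg (fun x => k1 t (X 0 x)).
  by apply: (@intg_bounded _ _ _ _ _ B) => //; exact: measurableT_comp.
apply: (le_trans (le_normr_Rintegral _ _)) => //.
apply: (@le_trans _ _ (\int[P]_x B)); last by rewrite RintegralP_cst.
apply: le_Rintegral => //; last exact: intg_cst.
by apply: (@intg_bounded _ _ _ _ _ B) => [|x]; [do 2 apply: measurableT_comp => //|rewrite normr_id].
Qed.

Let iG i : intg (fun x => G (tau i x)).
Proof.
apply: (@intg_bounded _ _ _ _ _ B); first exact: measurableT_comp.
by move=> x; rewrite ger0_norm ?G_ge0// G_le.
Qed.

Let akk (k : R -> R -> R) i : measurable_fun [set: R * R] (fun p => k p.1 p.2) ->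
  adapted zeta i.*2.+1 (fun x => k (tau i x) (X i x)).
Proof.
move=> mk; apply: (adapted_comp mk (Z := fun x => (tau i x, X i x))).
by apply: adapted_pair; [exact: adaptedS|exact: adapted_zeta].
Qed.

(** The noise part has mean 0, because [e i] is independent of [tau i] and [X i] and is centred; in
    the other part [tau i] is frozen and [G_drift] applies. *)
Let drift_le i : intg (fun x => (tau i x - theta) * H i x) /\
  \int[P]_x ((tau i x - theta) * H i x) <= - \int[P]_x G (tau i x).
Proof.
have B0 : 0 <= B by exact: le_trans (normr_ge0 _) (k1_bnd 0 0).
pose k1' (t x : R) := (t - theta) * k1 t x.
pose k2' (t x : R) := (t - theta) * k2 t x.
have mk1' : measurable_fun [set: R * R] (fun p => k1' p.1 p.2).
  by apply: measurable_funM => //; apply: measurable_funB.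
have mk2' : measurable_fun [set: R * R] (fun p => k2' p.1 p.2).
  by apply: measurable_funM => //; apply: measurable_funB.
have bk (k : R -> R -> R) x : (forall t x, `|k t x| <= B) ->
    `|(tau i x - theta) * k (tau i x) (X i x)| <= B.
  by move=> kB; rewrite normrM -[leRHS]mul1r ler_pM// dtau_le.
have i1 : intg (fun x => k1' (tau i x) (X i x)).
  apply: (@intg_bounded _ _ _ _ _ B) => [|x]; last exact: bk.
  exact: adapted_measurable (akk k1' i mk1').
have i2 : intg (fun x => k2' (tau i x) (X i x)).
  apply: (@intg_bounded _ _ _ _ _ B) => [|x]; last exact: bk.
  exact: adapted_measurable (akk k2' i mk2').
have i2e : intg (fun x => k2' (tau i x) (X i x) * e i x).
  apply: (intg_le _ (intgZ B (iabse i))).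
    by apply: measurable_funM => //; exact: adapted_measurable (akk k2' i mk2').
  by move=> x; rewrite normrM ler_wpM2r//; exact: bk.
have HE : (fun x => (tau i x - theta) * H i x) =
    (fun x => k1' (tau i x) (X i x) + k2' (tau i x) (X i x) * e i x).
  by apply/funext => x; rewrite /H /k1' /k2'; ring.
rewrite HE; split; first exact: intgD.
rewrite RintegralD//.
rewrite [X in _ + X <= _](_ : _ = 0); last first.
  have -> := adapted_RintegralM zeta_indep (akk k2' i mk2') (measurable_id (D := setT))
    i2e (ie i) i2.
  by rewrite [X in _ * X](e_mean i) mulr0.
rewrite addr0.
have mk1 t : measurable_fun [set: R] (k1 t) by exact: (measurable_fun_pair2 _ k1_measurable).
have ik t : intg (fun x => k1 t (X i x)).
  by apply: (@intg_bounded _ _ _ _ _ B) => //; exact: measurableT_comp.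
have [iE ->] := adapted_Rintegral zeta_indep (tau_adapted i) mk1' i1
  (fun z => intgZ (z - theta) (ik z)).
rewrite -mulN1r -RintegralZl//; apply: le_Rintegral => //; first exact: intgZ.
move=> x _; rewrite mulN1r (_ : \int[P]_y _ = (tau i x - theta) * \int[P]_y k1 (tau i x) (X i y)).
  exact: G_drift.
by rewrite -RintegralZl.
Qed.

Let EVS i : \int[P]_x V i.+1 x <= \int[P]_x V i x -
  2 / i.+1%:R * \int[P]_x G (tau i x) + i.+1%:R ^- 2 * (2 * B ^+ 2 * (1 + N)).
Proof.
have [iH EH] := drift_le i.
have i1e : intg (fun x => 1 + e i x ^+ 2) by exact: intgD (intg_cst _ _) (e_sqr i).
have i2e := intgZ (i.+1%:R ^- 2) (intgZ (2 * B ^+ 2) i1e).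
have i1H := intgZ (2 / i.+1%:R) iH.
apply: (@le_trans _ _ (\int[P]_x (V i x + 2 / i.+1%:R * ((tau i x - theta) * H i x) +
  i.+1%:R ^- 2 * (2 * B ^+ 2 * (1 + e i x ^+ 2))))).
  apply: le_Rintegral => //; first [exact: intgD (intgD (iV i) i1H) i2e|move=> x _; exact: VS].
rewrite RintegralD//; last exact: intgD (iV i) i1H.
rewrite RintegralD// !RintegralZl//; last exact: intgZ.
rewrite RintegralD//; last exact: intg_cst.
rewrite RintegralP_cst; apply: lerD.
  rewrite lerD2l -mulrN ler_wpM2l//.
by rewrite !ler_wpM2l ?lerD2l// mulr_ge0 ?sqr_ge0.
Qed.

Lemma robbins_monro_cvg :
  {ae P, forall x, tau n x @[n --> \oo] --> theta}.
Proof.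
have B0 : 0 <= B by exact: le_trans (normr_ge0 _) (k1_bnd 0 0).
pose Z n x := G (tau n x) / n.+1%:R.
have iZ n : intg (Z n).
  by rewrite /Z; under eq_fun do rewrite mulrC; exact: intgZ.
have Z0 n x : 0 <= Z n x by rewrite divr_ge0// G_ge0.
(* Summing [EVS] telescopes the expectations of [V]. *)
have EZ n : 2 * \sum_(i < n) \int[P]_x Z i x <=
    \int[P]_x V 0 x - \int[P]_x V n x +
    \sum_(i < n) i.+1%:R ^- 2 * (2 * B ^+ 2 * (1 + N)).
  elim: n => [|n IH]; first by rewrite !big_ord0 mulr0 subrr addr0.
  have En : \int[P]_x Z n x = n.+1%:R^-1 * \int[P]_x G (tau n x).
    by rewrite -RintegralZl//; apply: eq_Rintegral => x _; rewrite mulrC.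
  rewrite !big_ord_recr/= En mulrDr [X in _ + X <= _]mulrA.
  move: IH (EVS n); set q := 2 / _ * _; set r := n.+1%:R ^- 2 * _; lra.
have EZM n : \sum_(i < n) \int[P]_x Z i x <=
    (\int[P]_x V 0 x + 2 * (2 * B ^+ 2 * (1 + N))) / 2.
  rewrite ler_pdivlMr// mulrC; apply: (le_trans (EZ n)); apply: lerD.
    by rewrite gerBl; apply: Rintegral_ge0 => x _; exact: sqr_ge0.
  rewrite -mulr_suml ler_wpM2r ?sum_inv_sqr_le//.
  by rewrite !mulr_ge0// ?sqr_ge0// addr_ge0.
have := ae_bounded_partial_sums iZ Z0 EZM.
apply: filterS2 slln_abs_noise => x habs [M HM].
(* Since |k1| and |k2| are at most [B], the step is at most B (1 + |e_i|) / (i+1); its numerator has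
   mean at most B (2 + N) because E|e_i| <= 1 + N. *)
apply: (@slow_oscillation_cvg _ (tau ^~ x) (fun i => B * (1 + `|e i x|))
  (fun i => B * (1 + \int[P]_y `|e i y|)) (B * (2 + N)) M theta G).
- move=> n; rewrite tauS.
  have := @proj_quarter_dist (tau n x + 1 / n.+1%:R * H n x) (tau n x) (tau_bnd n x).
  move/le_trans; apply; rewrite addrAC subrr add0r normrM mulrC.
  rewrite div1r normfV normr_nat ler_wpM2r// /H.
  apply: (le_trans (ler_normD _ _)); rewrite mulrDr mulr1 lerD//.
  by rewrite normrM ler_wpM2r.
- by move=> n; rewrite mulr_ge0// addr_ge0.
- move=> n; rewrite ler_wpM2l//; have := mean_abs_noise_le n; lra.
- apply: (cvg_near_eq (cvgM habs (cvg_cst B))); first by rewrite mul0r.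
  near=> n => /=; rewrite -mulrA; congr (_ * _); rewrite mulr_suml; apply: eq_bigr => i _; ring.
- by move=> n; exact: G_ge0.
- exact: HM.
- move=> r /G_away[k k0 Hk]; exists k => // n; exact: Hk.
Unshelve. all: by end_near. Qed.

End robbins_monro.
End strong_laws.

(** * Lebesgue integrals on the line, densities and kernels *)

Section real_line.
Context {R : realType}.
Local Notation mu := (@lebesgue_measure R).
Local Notation D := (`[- (1 / 2), 1 / 2]%classic : set R).

(** On nonnegative reals the inverse is the power -1; both conventions give 0 at 0, so zeros of [g]
    are allowed. *)
Lemma measurable_fun_inv_ge0 d (T : measurableType d) (g : T -> R) :
  measurable_fun [set: T] g -> (forall x, 0 <= g x) ->
  measurable_fun [set: T] (fun x => (g x)^-1).
Proof.
move=> mg g0; rewrite (_ : (fun _ => _) = (@powR R ^~ (-1)) \o g).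
  by apply: measurableT_comp => //; exact: measurable_powR.
by apply/funext => x /=; rewrite powR_inv1.
Qed.

(** The image of Lebesgue measure under the affine map, divided by [h], gives half-open intervals
    their length, so it is Lebesgue measure by uniqueness. *)
Lemma lebesgue_measure_affine (c h : R) (A : set R) : 0 < h -> measurable A ->
  mu ((fun x => (x - c) / h) @^-1` A) = (h%:E * mu A)%E.
Proof.
move=> h0 mA.
pose phi : R -> measurableTypeR R := fun x => (x - c) / h.
have mphi : measurable_fun [set: measurableTypeR R] phi.
  by apply: measurable_funM => //; exact: measurable_funB.
pose r : {nonneg R} := NngNum (ltW (eq_rect _ is_true h0 _ (esym (invr_gt0 h)))).
rewrite (@lebesgue_measure_unique _ (mscale r (pushforward mu phi)) _ A)//.
- rewrite /mscale/= /pushforward muleA -EFinM divff ?gt_eqF// mul1e//.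
- move=> _ [[a b]] _ <-.
  have pre : phi @^-1` `]a, b]%classic = `](h * a + c), (h * b + c)]%classic; last first.
    apply: (@etrans _ _ (h^-1%:E * mu `](h * a + c)%R, (h * b + c)%R]%classic)%E); last first.
      by rewrite -pre.
    rewrite !lebesgue_measure_itv/= !lte_fin ltrD2r ltr_pM2l//.
    case: ifP => _; last by rewrite mule0.
    by rewrite -!EFinB -EFinM; congr (_%:E); field; rewrite gt_eqF.
  apply/seteqP; split => x /=; rewrite !in_itv/= /phi;
   rewrite ltr_pdivlMr// ler_pdivrMr// ![_ * h]mulrC; move=> /andP[? ?]; apply/andP; split; lra.
Qed.

Lemma ge0_integral_affine (c h : R) (A : set R) (f : R -> \bar R) : 0 < h ->
  measurable A -> measurable_fun A f -> (forall x, A x -> (0 <= f x)%E) ->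
  (\int[mu]_(x in (fun x : R => (x - c) / h)%R @^-1` A) f ((x - c) / h)%R =
   h%:E * \int[mu]_(x in A) f x)%E.
Proof.
move=> h0 mA mf f0.
pose phi : measurableTypeR R -> measurableTypeR R := fun x => (x - c) / h.
have mphi : measurable_fun [set: measurableTypeR R] phi.
  by apply: measurable_funM => //; exact: measurable_funB.
have := @ge0_integral_pushforward _ _ _ _ R phi mphi mu A f mA mf.
rewrite /comp/= => <-; last by move=> x; rewrite inE; exact: f0.
pose r : {nonneg R} := NngNum (ltW h0).
rewrite (@eq_measure_integral _ _ _ _ (mscale r mu)); last first.
  by move=> B mB _; exact: lebesgue_measure_affine.
by rewrite ge0_integral_mscale.
Qed.

Lemma Rintegral_shift (c a b : R) (f : R -> R) : continuous f ->
  \int[mu]_(x in `[a + c, b + c]) f (x - c) = \int[mu]_(x in `[a, b]) f x.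
Proof.
move=> cf.
pose phi : measurableTypeR R -> measurableTypeR R := fun x => x - c.
have mphi : measurable_fun [set: measurableTypeR R] phi by exact: measurable_funB.
have pre : phi @^-1` `[a, b] = `[a + c, b + c]%classic.
  by apply/seteqP; split => x /=; rewrite !in_itv/= /phi;
    rewrite lerBrDr lerBlDr.
have mf : measurable_fun [set: R] (EFin \o f).
  by apply/measurable_EFinP; exact: continuous_measurable_fun.
have intf : mu.-integrable (phi @^-1` `[a, b]) ((EFin \o f) \o phi).
  rewrite pre; apply: continuous_compact_integrable; first exact: segment_compact.
  apply: continuous_subspaceT => x; apply: continuous_comp; last exact: cf.
  by apply: cvgB; [exact: cvg_id|exact: cvg_cst].
rewrite /Rintegral; congr fine.
have := @integral_pushforward _ _ _ _ R phi mphi mu `[a, b]%classic (EFin \o f) mf intf.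
rewrite pre => <-//.
apply: eq_measure_integral => A mA _; rewrite /pushforward.
have H : mu (phi @^-1` A) = mu A.
  rewrite -[RHS]mul1e -(lebesgue_measure_affine c _ A ltr01 mA); congr (mu _).
  by apply/seteqP; split => x; rewrite /= divr1.
by first [exact: H|exact: esym H].
Qed.

(** The part of the shifted interval beyond 1/2 is the translate by one period of the part of D that
    it leaves uncovered on the left. *)
Lemma Rintegral_periodic (u : R) (f : R -> R) : continuous f ->
  (forall x, f (x + 1) = f x) -> `|u| <= 1 ->
  \int[mu]_(x in D) f (x - u) = \int[mu]_(x in D) f x.
Proof.
move=> cf per.
have intf a b : mu.-integrable `[a, b]%classic (EFin \o f).
  apply: continuous_compact_integrable; first exact: segment_compact.
  exact: continuous_subspaceT.
(* A nonpositive [u] gives v = -u; a positive one gives v = 1 - u after adding a period. *)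
suff pos v : 0 <= v <= 1 -> \int[mu]_(x in D) f (x + v) = \int[mu]_(x in D) f x.
  rewrite ler_norml => /andP[u1 u2]; have [u0|u0] := leP u 0.
    by apply: pos; apply/andP; split; lra.
  under eq_Rintegral do rewrite -per -addrA.
  by apply: pos; apply/andP; split; lra.
move=> /andP[v0 v1].
have -> : \int[mu]_(x in D) f (x + v) = \int[mu]_(x in `[- (1 / 2) + v, 1 / 2 + v]) f x.
  have := Rintegral_shift (- v) (- (1 / 2) + v) (1 / 2 + v) f cf; rewrite !addrK => <-.
  by apply: eq_Rintegral => x _; rewrite opprK.
have E1 := @Rintegral_itvB R f (BLeft (- (1 / 2) + v)) (BRight (1 / 2 + v)) (1 / 2) (intf _ _).
have E2 := @Rintegral_itvB R f (BLeft (- (1 / 2))) (BRight (1 / 2)) (- (1 / 2) + v) (intf _ _).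
have h1 : (BLeft (- (1 / 2) + v) <= BRight (1 / 2 : R))%O by rewrite bnd_simp; lra.
have h2 : (BRight (1 / 2 : R) <= BRight (1 / 2 + v))%O by rewrite bnd_simp; lra.
have h3 : (BLeft (- (1 / 2)) <= BRight (- (1 / 2) + v))%O by rewrite bnd_simp; lra.
have h4 : (BRight (- (1 / 2) + v) <= BRight (1 / 2 : R))%O by rewrite bnd_simp; lra.
have {}E1 := E1 h1 h2; have {}E2 := E2 h3 h4.
have E3 : \int[mu]_(x in `](1 / 2), (1 / 2 + v)]) f x =
          \int[mu]_(x in `[- (1 / 2), (- (1 / 2) + v)]) f x.
  rewrite Rintegral_itv_obnd_cbnd; last first.
    by apply: integrableS (intf (1 / 2) (1 / 2 + v)) => //; move=> x /=; rewrite !in_itv/=;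
      move=> /andP[? ?]; apply/andP; split; lra.
  have := Rintegral_shift 1 (- (1 / 2)) (- (1 / 2) + v) f cf.
  have -> : - (1 / 2) + 1 = 1 / 2 :> R by lra.
  have -> : - (1 / 2) + v + 1 = 1 / 2 + v :> R by lra.
  by move=> <-; apply: eq_Rintegral => x _; rewrite -[in LHS](subrK 1 x) per.
have E4 : \int[mu]_(x in `](- (1 / 2) + v), (1 / 2)]) f x =
          \int[mu]_(x in `[(- (1 / 2) + v), (1 / 2)]) f x.
  rewrite Rintegral_itv_obnd_cbnd//.
  by apply: integrableS (intf (- (1 / 2) + v) (1 / 2)) => //; move=> x /=; rewrite !in_itv/=;
      move=> /andP[? ?]; apply/andP; split; lra.
rewrite E3 in E1; rewrite E4 in E2; lra.
Qed.

Section fourier.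
Variable f : R -> R.
Hypotheses (f_cont : continuous f) (f_per : forall x, f (x + 1) = f x).

Let int_cont (F : R -> R) : continuous F -> mu.-integrable D (EFin \o F).
Proof.
move=> cF; apply: continuous_compact_integrable; first exact: segment_compact.
exact: continuous_subspaceT.
Qed.

Lemma continuous_affine_comp (F : R -> R) (k c : R) : continuous F ->
  continuous (fun x => F (k * (x - c))).
Proof.
move=> cF x; apply: (@continuous_comp _ _ _ (fun x => k * (x - c)) F); last exact: cF.
by apply: cvgM; [exact: cvg_cst|apply: cvgB; [exact: cvg_id|exact: cvg_cst]].
Qed.

Lemma Rintegral_sin_even : (forall x, f (- x) = f x) ->
  \int[mu]_(x in D) (sin (2 * pi * x) * f x) = 0.
Proof.
move=> f_sym; pose F x := sin (2 * pi * x) * f x.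
have cF : continuous F.
  move=> x; apply: cvgM; last exact: f_cont.
  apply: (@continuous_comp _ _ _ (fun x => 2 * pi * x) sin); last exact: continuous_sin.
  by apply: cvgM; [exact: cvg_cst|exact: cvg_id].
have h : \int[mu]_(x in D) F x = \int[mu]_(x in D) (-1 * F x).
  have := @integration_by_substitution_oppr R F (- (1 / 2)) (1 / 2) _ _.
  rewrite opprK /Rintegral => -> //; last exact: continuous_subspaceT.
    congr fine; apply: eq_integral => x _ /=.
    by rewrite /F mulrN sinN f_sym mulN1r mulNr.
  by lra.
have := h; rewrite RintegralZl//; last exact: int_cont.
rewrite -/(F _); set I := \int[mu]_(x in D) F x; lra.
Qed.

Lemma sin_cos_shift_period (F : R -> R) (c : R) :
  (forall x, F (x + 2 * pi) = F x) -> forall x, F (2 * pi * (x + 1 - c)) = F (2 * pi * (x - c)).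
Proof. by move=> per x; rewrite -[RHS]per; congr F; ring. Qed.

Hypothesis f_sym : forall x, f (- x) = f x.

(** After recentring at theta, the addition formula leaves a sine and a cosine coefficient of [f].
    Evenness kills the first, so the drift of the recursion for theta is a multiple of sin (2 pi
    (theta - t)). *)
Lemma Rintegral_sin_shift (t theta : R) : `|theta| <= 1 ->
  \int[mu]_(x in D) (sin (2 * pi * (x - t)) * f (x - theta)) =
  sin (2 * pi * (theta - t)) * fourier1 f.
Proof.
move=> th1.
pose F x := sin (2 * pi * (x - (t - theta))) * f x.
have cF : continuous F.
  move=> x; apply: cvgM; last exact: f_cont.
  apply: continuous_affine_comp; exact: continuous_sin.
have cc (G : R -> R) : continuous G -> continuous (fun x => G (2 * pi * x) * f x).
  move=> cG x; apply: cvgM; last exact: f_cont.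
  apply: (@continuous_comp _ _ _ (fun x => 2 * pi * x) G); last exact: cG.
  by apply: cvgM; [exact: cvg_cst|exact: cvg_id].
transitivity (\int[mu]_(x in D) F (x - theta)).
  by apply: eq_Rintegral => x _; rewrite /F; congr (sin _ * _); ring.
rewrite Rintegral_periodic//; last first.
  by move=> x; rewrite /F sin_cos_shift_period ?f_per// => y; rewrite mulr_natl sinD2pi.
rewrite (_ : \int[mu]_(x in D) F x = \int[mu]_(x in D)
  (cos (2 * pi * (theta - t)) * (sin (2 * pi * x) * f x) +
   sin (2 * pi * (theta - t)) * (cos (2 * pi * x) * f x))); last first.
  apply: eq_Rintegral => x _; rewrite /F.
  have -> : 2 * pi * (x - (t - theta)) = 2 * pi * x + 2 * pi * (theta - t) by ring.
  by rewrite sinD; ring.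
have is_ := int_cont _ (cc _ (@continuous_sin R)).
have ic_ := int_cont _ (cc _ (@continuous_cos R)).
have mD : measurable (D : set (measurableTypeR R)) by exact: measurable_itv.
have is1 := integrableZl mD (cos (2 * pi * (theta - t))) is_.
have ic1 := integrableZl mD (sin (2 * pi * (theta - t))) ic_.
rewrite (RintegralD mD is1 ic1).
rewrite !RintegralZl// Rintegral_sin_even// mulr0 add0r.
by congr (_ * _); rewrite /fourier1.
Qed.

Lemma Rintegral_cos_shift (theta : R) : `|theta| <= 1 ->
  \int[mu]_(x in D) (cos (2 * pi * (x - theta)) * f (x - theta)) = fourier1 f.
Proof.
move=> th1; pose F x := cos (2 * pi * x) * f x.
have cF : continuous F.
  move=> x; apply: cvgM; last exact: f_cont.
  apply: (@continuous_comp _ _ _ (fun x => 2 * pi * x) cos); last exact: continuous_cos.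
  by apply: cvgM; [exact: cvg_cst|exact: cvg_id].
rewrite -[LHS]/(\int[mu]_(x in D) F (x - theta)) Rintegral_periodic//.
move=> x; rewrite /F f_per; congr (_ * _).
by rewrite mulrDr mulr1 mulr_natl cosD2pi.
Qed.

End fourier.

End real_line.

(** * Expectations of functions of a variable with density, and kernel means *)

Section density.
Context d (T : measurableType d) (R : realType) (P : probability T R).
Local Notation mu := (@lebesgue_measure R).
Local Notation D := (`[- (1 / 2), 1 / 2]%classic : set R).
Local Notation intg f := (P.-integrable [set: T] (EFin \o f)).

Variable g : R -> R.
Hypothesis g_pdf : is_pdf g.

Let mg : measurable_fun [set: R] g. Proof. by case: g_pdf. Qed.
Let g0 x : 0 <= g x. Proof. by case: g_pdf. Qed.
Let ig : mu.-integrable [set: R] (EFin \o g).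
Proof.
apply/integrableP; split; first exact/measurable_EFinP.
under eq_integral do rewrite /= ger0_norm//.
by case: g_pdf => _ _ ->; rewrite ltry.
Qed.

Section one_variable.
Variable X : {RV P >-> R}.
Hypothesis X_dens : has_density X g.

(** [has_density] speaks of sets only. The law is absolutely continuous, its Radon-Nikodym
    derivative has the same integrals as [g] over all measurable sets, hence equals [g] almost
    everywhere, and the change of variables follows. *)
Lemma ge0_integral_density (phi : R -> R) : measurable_fun [set: R] phi ->
  (forall x, 0 <= phi x) ->
  (\int[P]_x (phi (X x))%:E = \int[mu]_x (phi x * g x)%:E)%E.
Proof.
move=> mphi phi0.
have mX' : measurable_fun [set: T] (X : T -> measurableTypeR R).
  by move=> _ A mA; rewrite setTI; exact: measurable_funPTI.
pose X' : {RV P >-> measurableTypeR R} :=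
  HB.pack (X : T -> measurableTypeR R) (isMeasurableFun.Build _ _ _ _ _ mX').
pose nu := distribution P X'.
have numu : nu `<< mu.
  apply/null_content_dominatesP => A mA muA.
  rewrite [LHS]X_dens//; apply: null_set_integral => //.
  by apply/measurable_EFinP; exact: measurable_funTS.
have fmeas : measurable_fun [set: R] (EFin \o phi) by exact/measurable_EFinP.
rewrite -[LHS](@ge0_integral_distribution _ _ _ _ _ P X' (EFin \o phi))//.
rewrite -(@Radon_Nikodym_SigmaFinite.change_of_variables _ _ _ nu mu numu (EFin \o phi))//.
have mRN : measurable_fun [set: R] (Radon_Nikodym_SigmaFinite.f nu mu).
  exact: measurable_int (Radon_Nikodym_SigmaFinite.f_integrable numu).
apply: ae_eq_integral => //.
- exact: emeasurable_funM.
- by apply/measurable_EFinP; exact: measurable_funM.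
- have : ae_eq mu setT (Radon_Nikodym_SigmaFinite.f nu mu) (EFin \o g).
    apply: integral_ae_eq => //.
    + exact: Radon_Nikodym_SigmaFinite.f_integrable.
    + exact/measurable_EFinP.
    + by move=> A _ mA; rewrite -Radon_Nikodym_SigmaFinite.f_integral// [LHS]X_dens.
  by apply: filterS => x /= h _; rewrite EFinM h.
Qed.

(** The nonnegative case for [phi + M]; the constant cancels because [g] has integral 1. *)
Lemma Rintegral_density (phi : R -> R) (M : R) : measurable_fun [set: R] phi ->
  (forall x, `|phi x| <= M) ->
  \int[P]_x phi (X x) = \int[mu]_x (phi x * g x).
Proof.
move=> mphi phiM.
have M0 x : 0 <= phi x + M by have := phiM x; rewrite ler_norml => /andP[? _]; lra.
have mphiM : measurable_fun [set: R] (fun x => phi x + M) by exact: measurable_funD.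
have iphi : intg (fun x => phi (X x)).
  by apply: (@intg_bounded _ _ _ _ _ M) => //; exact: measurableT_comp.
have ipg : mu.-integrable [set: R] (EFin \o (fun x => phi x * g x)).
  apply: (le_integrable measurableT _ _ (integrableZl measurableT M ig)).
    by apply/measurable_EFinP; exact: measurable_funM.
  move=> x _ /=; rewrite lee_fin !normrM ler_wpM2r//.
  exact: le_trans (phiM x) (ler_norm _).
have iMg := integrableZl measurableT M ig.
have h := ge0_integral_density _ mphiM M0.
have : \int[P]_x (phi (X x) + M) = \int[mu]_x (phi x * g x + M * g x).
  by rewrite /Rintegral h; congr fine; apply: eq_integral => x _; rewrite mulrDl.
rewrite !RintegralD//; last exact: intg_cst.
rewrite RintegralP_cst RintegralZl//.
have -> : \int[mu]_x g x = 1 by rewrite /Rintegral; case: g_pdf => _ _ ->.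
by rewrite mulr1 => /addIr.
Qed.

Hypothesis g_out : forall x, x \notin `[- (1 / 2), 1 / 2] -> g x = 0.
Hypothesis g_in : forall x, x \in `[- (1 / 2), 1 / 2] -> g x != 0.

(** The reason why the estimators divide by [g]: expectations become plain Lebesgue integrals over
    one period. Outside that period the integrand carries the factor [g x = 0]. *)
Lemma Rintegral_density_div (psi : R -> R) (M : R) : measurable_fun [set: R] psi ->
  (forall x, `|psi x / g x| <= M) ->
  \int[P]_x (psi (X x) / g (X x)) = \int[mu]_(x in D) psi x.
Proof.
move=> mpsi psiM.
rewrite (Rintegral_density (fun x => psi x / g x) M)//; last first.
  by apply: measurable_funM => //; exact: measurable_fun_inv_ge0.
rewrite [RHS]Rintegral_mkcond; apply: eq_Rintegral => x _ /=.
rewrite patchE; case: ifPn => xD.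
  by rewrite divfK// g_in//; move: xD; rewrite inE.
by rewrite g_out ?mulr0//; apply: contra xD; rewrite inE.
Qed.

Section kernel.
Variables (K : R -> R) (h c : R).
Hypothesis h_gt0 : 0 < h.
Hypothesis K_meas : measurable_fun setT K.
Hypothesis K_ge0 : forall x, 0 <= K x.
Hypothesis K_sym : forall x, K (- x) = K x.
Hypothesis K_int : (\int[mu]_x (K x)%:E = 1)%E.
Variable MK : R.
Hypothesis K_le : forall x, K x <= MK.

Let Kh x := 1 / h * K ((x - c) / h).

Let mKh : measurable_fun [set: R] Kh.
Proof.
apply: measurable_funM => //; apply: measurableT_comp => //.
by apply: measurable_funM => //; exact: measurable_funB.
Qed.

Let Kh0 x : 0 <= Kh x. Proof. by rewrite /Kh mulr_ge0// divr_ge0// ltW. Qed.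

Let intKh (A : set R) : measurable A ->
  (\int[mu]_(x in (fun x : R => (x - c) / h)%R @^-1` A) (Kh x)%:E =
   \int[mu]_(x in A) (K x)%:E)%E.
Proof.
move=> mA.
have mKA : measurable_fun A (EFin \o K).
  by apply/measurable_EFinP; exact: measurable_funS K_meas.
have K0 x : A x -> (0 <= (EFin \o K) x)%E by move=> _; rewrite lee_fin.
have := ge0_integral_affine c h A (EFin \o K) h_gt0 mA mKA K0.
rewrite /= => hE.
have mpre : measurable ((fun x : R => (x - c) / h) @^-1` A).
  have mphi : measurable_fun [set: R] (fun x : R => (x - c) / h).
    by apply: measurable_funM => //; exact: measurable_funB.
  by have := mphi measurableT A mA; rewrite setTI.
under eq_integral do rewrite /Kh EFinM.
rewrite ge0_integralZl//; last 3 first.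
- apply/measurable_EFinP; apply: measurable_funTS; apply: measurableT_comp => //.
  by apply: measurable_funM => //; exact: measurable_funB.
- by move=> x _; rewrite lee_fin.
- by rewrite lee_fin divr_ge0// ltW.
rewrite hE muleA -EFinM div1r mulVf ?gt_eqF// mul1e//.
Qed.

(** The two half-lines cover the line and have equal mass by symmetry of [K]. *)
Lemma kernel_half_mass (b : bool) :
  ((1 / 2)%:E <= \int[mu]_(x in if b then `]-oo, 0%R]%classic else `[0%R, +oo[%classic) (K x)%:E)%E.
Proof.
have mK : measurable_fun [set: R] (EFin \o K) by exact/measurable_EFinP.
have sub0 : (\int[mu]_(x in `[0%R, +oo[) (K x)%:E = \int[mu]_(x in `]-oo, 0%R]) (K x)%:E)%E.
  rewrite (ge0_integration_by_substitution0 (f := EFin \o K))//=.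
  by apply: eq_integral => x _; rewrite K_sym.
suff : ((1 / 2)%:E <= \int[mu]_(x in `]-oo, 0%R]) (K x)%:E)%E.
  by case: b => //; rewrite sub0.
have : (1 <= \int[mu]_(x in `]-oo, 0%R]) (K x)%:E + \int[mu]_(x in `[0%R, +oo[) (K x)%:E)%E.
  rewrite -K_int.
  have -> : [set: R] = `]-oo, 0%R] `|` `]0%R, +oo[.
    by rewrite -setCitvl setUv.
  rewrite ge0_integral_setU//=.
  - apply: leeD => //; apply: ge0_subset_integral => //.
    + by apply: measurable_funTS.
    + by move=> x _; rewrite lee_fin.
    + by move=> x /=; rewrite !in_itv/= !andbT; exact: ltW.
  - by apply: measurable_funTS.
  - by move=> x _; rewrite lee_fin.
  - by apply/disj_setPRL => x /=; rewrite !in_itv/= andbT; move=> x0 /= ; apply/negP; rewrite -ltNge.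
rewrite sub0; case: (\int[mu]_(x in _) _)%E => [r| |] //.
  by rewrite -EFinD !lee_fin => ?; lra.
by move=> _; rewrite leey.
Qed.

Lemma kernel_mean_le (gM : R) : (forall x, g x <= gM) ->
  \int[P]_x Kh (X x) <= gM.
Proof.
move=> gMP; rewrite /Rintegral -lee_fin.
have gM0 : 0 <= gM by exact: le_trans (g0 0) (gMP 0).
have hle : (\int[P]_x (Kh (X x))%:E <= gM%:E)%E.
  rewrite ge0_integral_density//.
  apply: (@le_trans _ _ (\int[mu]_x (gM%:E * (Kh x)%:E))%E).
    apply: ge0_le_integral => //.
    - by move=> x _; rewrite lee_fin mulr_ge0.
    - by apply/measurable_EFinP; exact: measurable_funM.
    - by apply/measurable_EFinP; exact: measurable_funM.
    - by move=> x _; rewrite lee_fin mulrC ler_wpM2r.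
  rewrite ge0_integralZl//; last 2 first.
  - exact/measurable_EFinP.
  - by move=> x _; rewrite lee_fin.
  have := intKh setT measurableT; rewrite preimage_setT => ->.
  by rewrite K_int mule1.
rewrite fineK// ge0_fin_numE; first exact: le_lt_trans hle (ltry _).
by apply: integral_ge0 => x _; rewrite lee_fin.
Qed.

(* One half of the window around c lies in the support of the density. *)
Lemma kernel_mean_ge (gm w : R) : 0 <= gm ->
  (forall x, x \in `[- (1 / 2), 1 / 2] -> gm <= g x) ->
  (forall x, K x != 0 -> `|x| <= w) ->
  (- (1 / 2) <= c - w * h /\ c <= 1 / 2) \/ (- (1 / 2) <= c /\ c + w * h <= 1 / 2) ->
  gm / 2 <= \int[P]_x Kh (X x).
Proof.
move=> gm0 gmP Kw side.
have iKh : intg (fun x => Kh (X x)).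
  apply: (@intg_bounded _ _ _ _ _ (1 / h * MK)); first exact: measurableT_comp.
  move=> x; rewrite ger0_norm// ler_wpM2l//; by rewrite divr_ge0// ltW.
rewrite -lee_fin Rintegral_EFin// ge0_integral_density//.
(* Whether the left half of the window fits in the support; if it does not, [side] says that the
   right half does. *)
pose b : bool := `[< - (1 / 2) <= c - w * h /\ c <= 1 / 2 >].
pose A : set R := if b then `]-oo, 0%R]%classic else `[0%R, +oo[%classic.
have mA : measurable A by rewrite /A; case: ifP.
pose B := (fun x : R => (x - c) / h) @^-1` A.
have mB : measurable B.
  have mphi : measurable_fun [set: R] (fun x : R => (x - c) / h).
    by apply: measurable_funM => //; exact: measurable_funB.
  by have := mphi measurableT A mA; rewrite setTI.
apply: (@le_trans _ _ (\int[mu]_(x in B) (gm%:E * (Kh x)%:E))%E).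
  rewrite ge0_integralZl//; last 2 first.
  - by apply/measurable_EFinP; exact: measurable_funTS.
  - by move=> x _; rewrite lee_fin.
  rewrite intKh// EFinM lee_wpmul2l ?lee_fin//.
  by have := kernel_half_mass b; rewrite /A div1r.
apply: (@le_trans _ _ (\int[mu]_(x in B) (Kh x * g x)%:E)%E).
  apply: ge0_le_integral => //.
  - by move=> x _; rewrite lee_fin mulr_ge0.
  - by apply/measurable_EFinP; apply: measurable_funTS; exact: measurable_funM.
  - by apply/measurable_EFinP; apply: measurable_funTS; exact: measurable_funM.
  - move=> x Bx; rewrite lee_fin mulrC.
    have [K0|K0] := eqVneq (K ((x - c) / h)) 0; first by rewrite /Kh K0 mulr0 !mul0r.
    rewrite ler_wpM2l//; apply: gmP.
    have := Kw _ K0; rewrite ler_norml ler_pdivlMr// ler_pdivrMr// => /andP[h1 h2].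
    move: Bx; rewrite /B /A /= /b; case: asboolP => [[s1 s2]|ns] /=; rewrite !in_itv/=.
      by rewrite pmulr_lle0 ?invr_gt0// => ?; apply/andP; split; lra.
    rewrite andbT pmulr_lge0 ?invr_gt0// => ?.
    by case: side => // -[s1 s2]; apply/andP; split; lra.
apply: ge0_subset_integral => //.
- by apply/measurable_EFinP; exact: measurable_funM.
- by move=> x _; rewrite lee_fin mulr_ge0.
Qed.

End kernel.
End one_variable.
End density.

(** * Bounds drawn from the hypotheses, and limits of weighted averages *)

Section real_functions.
Context {R : realType}.
Implicit Types f g : R -> R.

Lemma bounded_fun_le f : bounded_fun f -> exists M, forall x, `|f x| <= M.
Proof.
by move=> /pinfty_ex_gt0[M M0 fM]; exists M => x; exact: fM.
Qed.

Lemma lipschitz_le f : lipschitz f ->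
  exists2 L, 0 < L & forall x y, `|f x - f y| <= L * `|x - y|.
Proof.
by move=> /pinfty_ex_gt0[L L0 fL]; exists L => // x y; exact: (fL (x, y)).
Qed.

Lemma lipschitz_le_continuous f (L : R) : 0 < L ->
  (forall x y, `|f x - f y| <= L * `|x - y|) -> continuous f.
Proof.
move=> L0 fL x; apply/cvgrPdist_le => e e0.
near=> y; apply: (le_trans (fL x y)); rewrite -ler_pdivlMl// mulrC.
near: y; have /cvgrPdist_le := @cvg_id _ (nbhs x); apply.
by rewrite divr_gt0.
Unshelve. all: by end_near. Qed.

(** Relative continuity on the compact segment gives extrema, and the minimum is positive; this
    lower bound is what makes 1/g bounded. *)
Lemma pdf_segment g : fun_support g = `[- (1 / 2), 1 / 2]%classic ->
  (forall x : R, x \in `[- (1 / 2), 1 / 2] -> 0 < g x) ->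
  {within `[- (1 / 2), 1 / 2], continuous g} ->
  (forall x, x \notin `[- (1 / 2), 1 / 2] -> g x = 0) /\
  exists2 m, 0 < m & exists M,
    (forall x, x \in `[- (1 / 2), 1 / 2] -> m <= g x) /\ (forall x, g x <= M).
Proof.
move=> gs gp gc.
have gout x : x \notin `[- (1 / 2), 1 / 2] -> g x = 0.
  move=> xn; apply/eqP; apply: contraNT xn => gx.
  have : fun_support g x by apply: subset_closure.
  by rewrite gs.
have le12 : - (1 / 2) <= 1 / 2 :> R by lra.
have [c cD gc1] := EVT_min le12 gc; have [c' cD' gc2] := EVT_max le12 gc.
split=> //; exists (g c); first exact: gp.
exists (g c'); split=> // x.
have [xD|xD] := boolP (x \in `[- (1 / 2), 1 / 2]); first exact: gc2.
by rewrite gout// ltW// gp.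
Qed.

Lemma compact_support_le f : compact (fun_support f) ->
  exists2 w, 0 < w & forall x, f x != 0 -> `|x| <= w.
Proof.
move=> /compact_bounded /pinfty_ex_gt0[w w0 fw]; exists w => // x fx.
by apply: fw; exact: subset_closure.
Qed.

Lemma powR_inv_cvg0 (alpha : R) : 0 < alpha ->
  (1 / n.+1%:R `^ alpha : R) @[n --> \oo] --> (0 : R).
Proof.
move=> a0; apply/cvgrPdist_le => e e0; near=> n.
rewrite sub0r normrN div1r ger0_norm ?invr_ge0 ?powR_ge0//.
rewrite -[leRHS]invrK lef_pV2 ?posrE ?powR_gt0 ?invr_gt0//.
have -> : e^-1 = ((e^-1) `^ alpha^-1) `^ alpha.
  by rewrite -powRrM mulVf ?gt_eqF// powRr1// invr_ge0 ltW.
apply: ge0_ler_powR; rewrite ?nnegrE ?powR_ge0// ?(ltW a0)//.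
near: n; have := @nbhs_infty_ger R ((e^-1) `^ alpha^-1).
by apply: filterS => n h; apply: (le_trans h); rewrite ler_nat.
Unshelve. all: by end_near. Qed.

(** For n >= 2 N0 the means sum to at least c n / 2, and the fluctuation eventually takes away at
    most c n / 4. *)
Lemma mean_lower_bound (w m : nat -> R) (c : R) (N0 : nat) : 0 < c ->
  (forall i, 0 <= m i) -> (forall i, (N0 <= i)%N -> c <= m i) ->
  (n%:R^-1 * \sum_(i < n) (w i - m i)) @[n --> \oo] --> (0 : R) ->
  \forall n \near \oo, c / 4 * n%:R <= \sum_(i < n) w i.
Proof.
move=> c0 m0 mc /cvgrPdist_le /(_ (c / 4) ltac:(by rewrite divr_gt0)).
move=> h; near=> n.
have n0 : 0 < n%:R :> R by rewrite ltr0n; near: n; exact: nbhs_infty_gt.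
have : `|0 - n%:R^-1 * \sum_(i < n) (w i - m i)| <= c / 4 by near: n; exact: h.
rewrite sub0r normrN normrM gtr0_norm ?invr_gt0// ler_pdivrMl// mulrC.
rewrite sumrB ler_norml => /andP[h1 _].
have Nn : (N0.*2 <= n)%N by near: n; exact: nbhs_infty_ge.
have N0n : (N0 <= n)%N by apply: leq_trans Nn; rewrite -addnn leq_addl.
have : c * (n - N0)%:R <= \sum_(i < n) m i.
  rewrite -(big_mkord xpredT m) (big_cat_nat (n := N0))//=.
  apply: (@le_trans _ _ (\sum_(N0 <= i < n) m i)).
    rewrite mulr_natr -sumr_const_nat; apply: ler_sum_nat => i /andP[? _]; exact: mc.
  by rewrite lerDr sumr_ge0.
rewrite natrB//.
have : N0%:R * 2 <= n%:R :> R by rewrite -natrM ler_nat muln2.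
nra.
Unshelve. all: by end_near. Qed.

Lemma sum_le_of_mean (w m : nat -> R) (C : R) :
  (forall i, m i <= C) ->
  (n%:R^-1 * \sum_(i < n) (w i - m i)) @[n --> \oo] --> (0 : R) ->
  exists C', forall n, \sum_(i < n) w i <= C' * n%:R.
Proof.
move=> mC h.
have [M MP] : exists M, forall n, `|n%:R^-1 * \sum_(i < n) (w i - m i)| <= M.
  have /pinfty_ex_gt0[M _ HM] := cvg_seq_bounded (cvgP _ h).
  by exists M => n; exact: HM.
exists (M + C) => n; case: (posnP n) => [->|n0]; first by rewrite big_ord0 mulr0.
have n0' : 0 < n%:R :> R by rewrite ltr0n.
have := MP n; rewrite normrM gtr0_norm ?invr_gt0// ler_pdivrMl// mulrC.
rewrite sumrB => /(le_trans (ler_norm _)).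
have : \sum_(i < n) m i <= C * n%:R.
  apply: (@le_trans _ _ (\sum_(i < n) C)); first exact: ler_sum.
  by rewrite sumr_const card_ord mulr_natr.
lra.
Qed.

(** The numerator minus [L] times the denominator is o(n), while the denominator is at least c n.
    The decomposition of [z] is multiplied by [w] because it is meaningful only where the weight
    does not vanish. *)
Lemma weighted_ratio_cvg (w e r z : nat -> R) (L C c : R) : 0 < c ->
  (forall i, 0 <= w i) -> (forall n, \sum_(i < n) w i <= C * n%:R) ->
  (\forall n \near \oo, c * n%:R <= \sum_(i < n) w i) ->
  (n%:R^-1 * \sum_(i < n) w i * e i) @[n --> \oo] --> (0 : R) ->
  r n @[n --> \oo] --> (0 : R) ->
  (forall i, w i * z i = w i * (L + r i + e i)) ->
  ((\sum_(i < n) w i * z i) / (\sum_(i < n) w i)) @[n --> \oo] --> L.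
Proof.
move=> c0 w0 wC wc we r0 wz.
have wr := weighted_cesaro r0 w0 wC.
have h0 : (n%:R^-1 * \sum_(i < n) w i * e i + n%:R^-1 * \sum_(i < n) w i * r i)
    @[n --> \oo] --> (0 + 0 : R) by exact: cvgD.
rewrite addr0 in h0; move/cvgrPdist_le : h0 => h.
apply/cvgrPdist_le => eps eps0; near=> n.
have n0 : 0 < n%:R :> R by rewrite ltr0n; near: n; exact: nbhs_infty_gt.
have wn : c * n%:R <= \sum_(i < n) w i by near: n.
have W0 : 0 < \sum_(i < n) w i by apply: lt_le_trans wn; rewrite mulr_gt0.
have : `|0 - (n%:R^-1 * \sum_(i < n) w i * e i + n%:R^-1 * \sum_(i < n) w i * r i)| <= eps * c.
  by near: n; apply: h; rewrite mulr_gt0.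
rewrite sub0r normrN -mulrDr normrM gtr0_norm ?invr_gt0// ler_pdivrMl// => hn.
have -> : \sum_(i < n) w i * z i = L * \sum_(i < n) w i +
    (\sum_(i < n) w i * e i + \sum_(i < n) w i * r i).
  rewrite mulr_sumr -!big_split/=; apply: eq_bigr => i _; rewrite wz; ring.
rewrite mulrDl mulfK ?gt_eqF// opprD addrA subrr sub0r normrN normrM.
rewrite normfV (gtr0_norm W0) ler_pdivrMr//; apply: (le_trans hn).
by rewrite mulrCA ler_wpM2l ?(ltW eps0)// mulrC.
Unshelve. all: by end_near. Qed.

End real_functions.

(** * Independence of the interleaved sequence *)

Section interleaving.
Context d (T : measurableType d) (R : realType) (P : probability T R).

(** Splitting the intersection by parity separates the noise from the observation times;
    independence of the two families factors the halves, and mutual independence factors each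
    half. *)
Lemma interleave_indep (I : eqType) (X : nat -> {RV P >-> R}) (E : I -> {RV P >-> R})
    (idx : nat -> I) : injective idx ->
  mutually_independent X -> mutually_independent E -> independent_families X E ->
  forall n (B : nat -> set R), (forall i, measurable (B i)) ->
  let zeta k : {RV P >-> R} := if odd k then E (idx k./2) else X k./2 in
  P (\big[setI/setT]_(i < n) (zeta i @^-1` B i)) =
  (\prod_(i < n) P (zeta i @^-1` B i))%E.
Proof.
move=> idxI iX iE iXE n B mB zeta.
rewrite -(big_mkord xpredT (fun i => zeta i @^-1` B i)).
rewrite -(big_mkord xpredT (fun i => P (zeta i @^-1` B i))).
rewrite (bigID odd)/= [RHS](bigID odd)/=.
pose so := [seq idx i./2 | i <- index_iota 0 n & odd i].
pose se := [seq i./2 | i <- index_iota 0 n & ~~ odd i].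
have oddE i : odd i -> i = (i./2).*2.+1 by move=> oi; rewrite -[LHS]odd_double_half oi.
have evenE i : ~~ odd i -> i = (i./2).*2.
  by move=> /negbTE oi; rewrite -[LHS]odd_double_half oi.
have uo : uniq so.
  rewrite map_inj_in_uniq ?filter_uniq ?iota_uniq// => i k.
  rewrite !mem_filter => /andP[oi _] /andP[ok _] /idxI ik.
  by rewrite (oddE _ oi) (oddE _ ok) ik.
have ue : uniq se.
  rewrite map_inj_in_uniq ?filter_uniq ?iota_uniq// => i k.
  rewrite !mem_filter => /andP[oi _] /andP[ok _] ik.
  by rewrite (evenE _ oi) (evenE _ ok) ik.
(* Mutual independence wants Borel sets indexed by [I], whereas [B] is indexed by time; a left
   inverse of [idx] transports them. *)
have [inv invK] : exists inv : I -> nat, cancel idx inv.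
  pose inv i := if pselect (exists k, idx k = i) is left h then proj1_sig (cid h) else 0%N.
  exists inv => k; rewrite /inv; case: pselect => [h|[]]; last by exists k.
  by apply: idxI; case: (cid h).
pose Bo i := B (inv i).*2.+1; pose Be k := B k.*2.
have Ao : \big[setI/setT]_(0 <= i < n | odd i) (zeta i @^-1` B i) =
    \big[setI/setT]_(i <- so) (E i @^-1` Bo i).
  rewrite /so big_map big_filter; apply: eq_bigr => i oi.
  by rewrite /zeta oi /Bo invK -oddE.
have Ae : \big[setI/setT]_(0 <= i < n | ~~ odd i) (zeta i @^-1` B i) =
    \big[setI/setT]_(i <- se) (X i @^-1` Be i).
  rewrite /se big_map big_filter; apply: eq_bigr => i oi.
  by rewrite /zeta (negbTE oi) /Be -evenE.
have Po : (\prod_(0 <= i < n | odd i) P (zeta i @^-1` B i))%E =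
    (\prod_(i <- so) P (E i @^-1` Bo i))%E.
  rewrite /so big_map big_filter; apply: eq_bigr => i oi.
  by rewrite /zeta oi /Bo invK -oddE.
have Pe : (\prod_(0 <= i < n | ~~ odd i) P (zeta i @^-1` B i))%E =
    (\prod_(i <- se) P (X i @^-1` Be i))%E.
  rewrite /se big_map big_filter; apply: eq_bigr => i oi.
  by rewrite /zeta (negbTE oi) /Be -evenE.
rewrite Ao Ae Po Pe setIC iXE.
- have mBo i : measurable (Bo i) by exact: mB.
  have mBe i : measurable (Be i) by exact: mB.
  by rewrite (iX se Be ue mBe) (iE so Bo uo mBo) muleC.
- apply: (@bigsetI_measurable _ (g_sigma_algebraType
    [set A | exists i, exists2 B : set R, measurable B & A = X i @^-1` B])) => i _.
  by apply: sub_sigma_algebra; exists i; exists (Be i) => //; exact: mB.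
- apply: (@bigsetI_measurable _ (g_sigma_algebraType
    [set A | exists i, exists2 B : set R, measurable B & A = E i @^-1` B])) => i _.
  by apply: sub_sigma_algebra; exists i; exists (Bo i) => //; exact: mB.
Qed.

End interleaving.

(** * One curve of the model *)

Section curve.
Context d (T : measurableType d) (R : realType) (P : probability T R).
Local Notation mu := (@lebesgue_measure R).
Local Notation D := (`[- (1 / 2), 1 / 2]%classic : set R).
Local Notation intg f := (P.-integrable [set: T] (EFin \o f)).

Variable zeta : nat -> {RV P >-> R}.
Hypothesis zeta_indep : forall n (B : nat -> set R), (forall i, measurable (B i)) ->
  P (\big[setI/setT]_(i < n) (zeta i @^-1` B i)) =
  (\prod_(i < n) P (zeta i @^-1` B i))%E.

Let X i : {RV P >-> R} := zeta i.*2.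
Let e i : {RV P >-> R} := zeta i.*2.+1.

Variables (g : R -> R) (gm gM : R).
Hypothesis g_pdf : is_pdf g.
Hypothesis g_out : forall x, x \notin `[- (1 / 2), 1 / 2] -> g x = 0.
Hypothesis gm_gt0 : 0 < gm.
Hypothesis g_ge : forall x, x \in `[- (1 / 2), 1 / 2] -> gm <= g x.
Hypothesis g_le : forall x, g x <= gM.
Hypothesis X_dens : forall i, has_density (X i) g.

Variable N : R.
Hypothesis e_sqr : forall i, intg (fun x => e i x ^+ 2).
Hypothesis e_var : forall i, \int[P]_x (e i x ^+ 2) <= N.
Hypothesis e_mean : forall i, \int[P]_x e i x = 0.

Variables (f : R -> R) (Mf L : R).
Hypothesis f_sym : forall x, f (- x) = f x.
Hypothesis f_per : forall x, f (x + 1) = f x.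
Hypothesis f_le : forall x, `|f x| <= Mf.
Hypothesis L_gt0 : 0 < L.
Hypothesis f_lip : forall x y, `|f x - f y| <= L * `|x - y|.
Hypothesis f_int : \int[mu]_(x in `[- (1 / 2), 1 / 2]) f x = 0.
Local Notation f1 := (fourier1 f).
Hypothesis f1_neq0 : f1 != 0.

Variables (a theta v : R).
Hypothesis a_neq0 : a != 0.
Hypothesis theta_lt : `|theta| < 1 / 4.

Let y i x := a * f (X i x - theta) + v + e i x.

Let g0 x : 0 <= g x. Proof. by case: g_pdf. Qed.

Let g_in x : x \in `[- (1 / 2), 1 / 2] -> g x != 0.
Proof. by move=> /g_ge gx; rewrite gt_eqF// (lt_le_trans gm_gt0). Qed.

Let mg_inv : measurable_fun [set: R] (fun x => (g x)^-1).
Proof. by apply: measurable_fun_inv_ge0; case: g_pdf. Qed.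

(* Outside the support [g x = 0], and then [(g x)^-1 = 0]. *)
Let g_inv_le x : `|(g x)^-1| <= gm^-1.
Proof.
rewrite ger0_norm ?invr_ge0//.
have [xD|xD] := boolP (x \in `[- (1 / 2), 1 / 2]).
  by rewrite lef_pV2 ?posrE ?g_ge// (lt_le_trans gm_gt0)// g_ge.
by rewrite g_out// invr0 invr_ge0 ltW.
Qed.

Let f_cont : continuous f. Proof. exact: lipschitz_le_continuous f_lip. Qed.

Let ff x := a * f (x - theta) + v.

Let ff_cont : continuous ff.
Proof.
move=> x; apply: cvgD; last exact: cvg_cst.
apply: cvgM; first exact: cvg_cst.
apply: (@continuous_comp _ _ _ (fun x => x - theta) f); last exact: f_cont.
by apply: cvgB; [exact: cvg_id|exact: cvg_cst].
Qed.

Let Mff := `|a| * Mf + `|v|.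

Let ff_le x : `|ff x| <= Mff.
Proof.
apply: (le_trans (ler_normD _ _)); rewrite lerD2r normrM.
exact: ler_wpM2l.
Qed.

Let mff : measurable_fun [set: R] ff. Proof. exact: continuous_measurable_fun. Qed.

Let int_cont (F : R -> R) : continuous F -> mu.-integrable D (EFin \o F).
Proof.
move=> cF; apply: continuous_compact_integrable; first exact: segment_compact.
exact: continuous_subspaceT.
Qed.

Let Rint_ff (c : R -> R) : continuous c ->
  \int[mu]_(x in D) (c x * ff x) =
  a * \int[mu]_(x in D) (c x * f (x - theta)) + v * \int[mu]_(x in D) (c x * 1).
Proof.
move=> cc.
have mD : measurable (D : set (measurableTypeR R)) by exact: measurable_itv.
have cf : continuous (fun x => c x * f (x - theta)).
  move=> x; apply: cvgM; first exact: cc.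
  apply: (@continuous_comp _ _ _ (fun x => x - theta) f); last exact: f_cont.
  by apply: cvgB; [exact: cvg_id|exact: cvg_cst].
have c1 : continuous (fun x => c x * 1).
  by move=> x; apply: cvgM; [exact: cc|exact: cvg_cst].
have i1 := int_cont _ cf; have i2 := int_cont _ c1.
have i1' := integrableZl mD a i1; have i2' := integrableZl mD v i2.
rewrite -!(RintegralZl _ mD)// -(RintegralD mD i1' i2').
by apply: eq_Rintegral => x _; rewrite /ff; ring.
Qed.

Let trig_affine_cont (F : R -> R) (c : R) : continuous F ->
  continuous (fun x => F (2 * pi * (x - c))).
Proof. exact: continuous_affine_comp. Qed.

(** A shift by half a period changes the sign of the cosine but not its integral. This is what
    removes the offset [v] from the estimators of theta and a. *)
Let fourier1_cst : fourier1 (fun=> 1 : R) = 0.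
Proof.
pose F (x : R) := cos (2 * pi * (x - 0)).
have cF : continuous F by apply: trig_affine_cont; exact: continuous_cos.
have perF x : F (x + 1) = F x.
  by rewrite /F !subr0 mulrDr mulr1 [2 * pi as X in _ + X]mulr_natl cosD2pi.
have h12 : `|1 / 2 : R| <= 1 by rewrite ger0_norm; lra.
have := Rintegral_periodic (1 / 2) F cF perF h12.
rewrite (_ : \int[mu]_(x in D) F (x - 1 / 2) = \int[mu]_(x in D) (- 1 * F x)); last first.
  apply: eq_Rintegral => x _; rewrite /F !subr0 mulN1r.
  have -> : 2 * pi * (x - 1 / 2) = 2 * pi * x - pi by field.
  by rewrite -[in RHS](subrK pi (2 * pi * x)) cosDpi opprK.
rewrite RintegralZl//; last exact: int_cont.
have -> : fourier1 (fun=> 1 : R) = \int[mu]_(x in D) F x.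
  by apply: eq_Rintegral => x _; rewrite /F subr0 mulr1.
lra.
Qed.

Let theta_le1 : `|theta| <= 1. Proof. by move: theta_lt; lra. Qed.

Let Rint_sin t : \int[mu]_(x in D) (sin (2 * pi * (x - t)) * ff x) =
  a * (sin (2 * pi * (theta - t)) * f1).
Proof.
rewrite (Rint_ff (fun x => sin (2 * pi * (x - t)))); last first.
  by apply: trig_affine_cont; exact: continuous_sin.
rewrite Rintegral_sin_shift//.
have h0 : `|0 : R| <= 1 by rewrite normr0.
have := @Rintegral_sin_shift R (fun=> 1) (fun=> cvg_cst _) (fun=> erefl) (fun=> erefl) t 0 h0.
by move=> ->; rewrite fourier1_cst !mulr0 addr0.
Qed.

Let Rint_cos : \int[mu]_(x in D) (cos (2 * pi * (x - theta)) * ff x) = a * f1.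
Proof.
rewrite (Rint_ff (fun x => cos (2 * pi * (x - theta)))); last first.
  by apply: trig_affine_cont; exact: continuous_cos.
rewrite Rintegral_cos_shift//.
have := @Rintegral_cos_shift R (fun=> 1) (fun=> cvg_cst _) (fun=> erefl) theta theta_le1.
by move=> ->; rewrite fourier1_cst mulr0 addr0.
Qed.

Let Rint_one : \int[mu]_(x in D) (1 * ff x) = v.
Proof.
rewrite (Rint_ff (fun=> 1)); last by move=> x; exact: cvg_cst.
under eq_Rintegral do rewrite mul1r.
rewrite Rintegral_periodic// f_int mulr0 add0r mul1r.
rewrite Rintegral_cst//= lebesgue_measure_itv/= lte_fin ifT; last by lra.
by rewrite -EFinB/= opprK; field.
Qed.

(** An observation is [ff (X i)] plus noise: division by [g] turns the mean of the first part into a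
    Lebesgue integral, and the second averages out. [c = 1] yields the offset, a cosine centred at
    theta the amplitude. *)
Lemma slln_inverse_density (c : R -> R) (M : R) : continuous c -> (forall x, `|c x| <= M) ->
  {ae P, forall x, (n%:R^-1 * \sum_(i < n) c (X i x) / g (X i x) * y i x) @[n --> \oo] -->
    \int[mu]_(x in D) (c x * ff x)}.
Proof.
move=> cc cM.
have M0 : 0 <= M by exact: le_trans (normr_ge0 _) (cM 0).
have mc : measurable_fun [set: R] c by exact: continuous_measurable_fun.
pose phi1 x := c x * ff x / g x; pose phi2 x := c x / g x.
have m1 : measurable_fun [set: R] phi1.
  by apply: measurable_funM => //; exact: measurable_funM.
have m2 : measurable_fun [set: R] phi2 by exact: measurable_funM.
have b1 x : `|phi1 x| <= M * Mff * gm^-1.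
  rewrite normrM ler_pM// normrM ler_pM//.
have b2 x : `|phi2 x| <= M * gm^-1 by rewrite normrM ler_pM.
have E1 i : \int[P]_x phi1 (X i x) = \int[mu]_(x in D) (c x * ff x).
  apply: (Rintegral_density_div _ _ _ _ g g_pdf _ (X_dens i) g_out g_in _ (M * Mff * gm^-1)) => //.
  exact: measurable_funM.
have s1 := slln_bounded _ _ _ _ zeta zeta_indep phi1 _ m1 b1 _ E1.
have s2 := slln_bounded_noise _ _ _ _ zeta zeta_indep N e_sqr e_var e_mean phi2 _ m2 b2.
apply: filterS2 s1 s2 => x h1 h2.
apply: (cvg_near_eq (cvgD h1 h2)); first by rewrite addr0.
near=> n => /=; rewrite -mulrDr -big_split/=; congr (_ * _).
apply: eq_bigr => i _; rewrite /phi1 /phi2 /y /ff /X /e; ring.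
Unshelve. all: by end_near. Qed.

Lemma vhat_cvg :
  {ae P, forall x, (n%:R^-1 * \sum_(i < n) y i x / g (X i x)) @[n --> \oo] --> v}.
Proof.
have n1 (x : R) : `|(fun=> 1 : R) x| <= 1 by rewrite normr1.
have c1 : continuous (fun _ : R => 1 : R) by move=> ?; exact: cvg_cst.
have hae := slln_inverse_density _ 1 c1 n1.
apply: filterS hae => x h; apply: (cvg_near_eq h); first exact: Rint_one.
near=> n; congr (_ * _); apply: eq_bigr => i _; ring.
Unshelve. all: by end_near. Qed.

Variables (t0 : R) (tau : nat -> T -> R).
Hypothesis t0_le : `|t0| <= 1 / 4.
Hypothesis tau0 : forall x, tau 0 x = t0.
Hypothesis tauS : forall i x, tau i.+1 x = proj_quarter (tau i x +
  1 / i.+1%:R * Num.sg (a * f1) *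
   (sin (2 * pi * (X i x - tau i x)) / g (X i x)) * y i x).

Let tau_bnd i x : `|tau i x| <= 1 / 4.
Proof.
case: i => [|i]; first by rewrite tau0.
rewrite tauS /proj_quarter ler_norml le_max lexx ge_max ge_min lexx/= andbT.
by lra.
Qed.

Let sgn := Num.sg (a * f1).
Let k2 (t x : R) := sgn * (sin (2 * pi * (x - t)) / g x).
Let k1 (t x : R) := k2 t x * ff x.

Let sgn_le : `|sgn| <= 1. Proof. by rewrite /sgn normr_sg; case: (_ != _). Qed.

Let sin_le (x : R) : `|sin x| <= 1.
Proof. by rewrite ler_norml sin_geN1 sin_le1. Qed.

Let k2_le t x : `|k2 t x| <= gm^-1.
Proof.
rewrite normrM -[leRHS]mul1r ler_pM// normrM -[leRHS]mul1r ler_pM//.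
Qed.

Let mk2 : measurable_fun [set: R * R] (fun p => k2 p.1 p.2).
Proof.
apply: measurable_funM => //; apply: measurable_funM.
  apply: measurableT_comp; first by apply: continuous_measurable_fun; exact: continuous_sin.
  by apply: measurable_funM => //; exact: measurable_funB.
exact: (measurableT_comp mg_inv measurable_snd).
Qed.

Let mk1 : measurable_fun [set: R * R] (fun p => k1 p.1 p.2).
Proof.
by apply: measurable_funM => //; exact: (measurableT_comp mff measurable_snd).
Qed.

(** The recursion as one measurable map of the triple (tau_i, X_i, e_i), so that adaptedness passes
    from tau_i to tau_(i+1) by composition. *)
Let step (p : R * (R * R)) (i : nat) : R :=
  proj_quarter (p.1 + 1 / i.+1%:R * (k1 p.1 p.2.1 + k2 p.1 p.2.1 * p.2.2)).

Let mstep i : measurable_fun [set: R * (R * R)] (step ^~ i).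
Proof.
have mp : measurable_fun [set: R * (R * R)] (fun p : R * (R * R) => (p.1, p.2.1)).
  by apply: measurable_fun_pair => //; exact: measurableT_comp.
have mk1' := measurableT_comp mk1 mp; have mk2' := measurableT_comp mk2 mp.
apply: measurable_maxr => //; apply: measurable_minr => //.
apply: measurable_funD => //; apply: measurable_funM => //.
apply: measurable_funD; first exact: mk1'.
by apply: measurable_funM; [exact: mk2'|exact: measurableT_comp].
Qed.

Let tauS' i x : tau i.+1 x = proj_quarter (tau i x + 1 / i.+1%:R *
  (k1 (tau i x) (X i x) + k2 (tau i x) (X i x) * e i x)).
Proof.
by rewrite tauS; congr (proj_quarter (_ + _)); rewrite /k1 /k2 /y /ff /sgn; ring.
Qed.

Let tau_adapted i : adapted zeta i.*2 (tau i).
Proof.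
elim: i => [|i IH].
  rewrite (_ : tau 0 = fun=> t0); first exact: adapted_cst.
  by apply/funext => x; rewrite tau0.
rewrite (_ : tau i.+1 = fun x => step (tau i x, (X i x, e i x)) i).
  apply: (adapted_comp (mstep i) (Z := fun x => (tau i x, (X i x, e i x)))).
  apply: adapted_pair; first by rewrite doubleS; do 2 apply: adaptedS.
  apply: adapted_pair; first by rewrite doubleS; apply: adaptedS; exact: adapted_zeta.
  exact: adapted_zeta.
by apply/funext => x; rewrite tauS'.
Qed.

Let G t := `|a * f1| * ((t - theta) * sin (2 * pi * (t - theta))).

Let G_drift i t : `|t| <= 1 / 4 -> (t - theta) * \int[P]_x k1 t (X i x) <= - G t.
Proof.
move=> _.
have E : \int[P]_x k1 t (X i x) = sgn * (a * (sin (2 * pi * (theta - t)) * f1)).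
  rewrite -Rint_sin.
  have cs : continuous (fun x => sin (2 * pi * (x - t)) * ff x).
    move=> x; apply: cvgM; last exact: ff_cont.
    by apply: trig_affine_cont; exact: continuous_sin.
  have b x : `|sin (2 * pi * (x - t)) * ff x / g x| <= 1 * Mff * gm^-1.
    by rewrite normrM ler_pM// normrM ler_pM.
  have h := Rintegral_density_div _ _ _ _ g g_pdf _ (X_dens i) g_out g_in _ _
    (continuous_measurable_fun cs) b.
  rewrite -h -RintegralZl//.
    by apply: eq_Rintegral => x _; rewrite /k1 /k2; ring.
  apply: (@intg_bounded _ _ _ _ _ (1 * Mff * gm^-1)) => //.
  have mq : measurable_fun [set: R] (fun x => sin (2 * pi * (x - t)) * ff x / g x).
    by apply: measurable_funM => //; exact: continuous_measurable_fun.
  exact: (measurableT_comp mq).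
rewrite E /G /sgn (normrEsg (a * f1)).
have -> : 2 * pi * (theta - t) = - (2 * pi * (t - theta)) by ring.
by rewrite sinN le_eqVlt; apply/orP; left; apply/eqP; ring.
Qed.

Let xsin_even (u : R) : u * sin (2 * pi * u) = `|u| * sin (2 * pi * `|u|).
Proof.
have [u0|u0] := leP 0 u; first by rewrite ger0_norm.
by rewrite ltr0_norm// [2 * pi * - u]mulrN sinN mulrNN.
Qed.

(** The strict bound on theta keeps this right-hand side below 1/2, and on [0, 1/2[ the function u
    sin (2 pi u) vanishes only at 0. This makes theta the only zero of [G] that the recursion can
    reach. *)
Let dtau_lt t : `|t| <= 1 / 4 -> `|t - theta| <= 1 / 4 + `|theta|.
Proof. by move=> ht; apply: (le_trans (ler_normB _ _)); rewrite lerD2r. Qed.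

Let sin2pi_gt0 (u : R) : 0 < u -> u < 1 / 2 -> 0 < sin (2 * pi * u).
Proof.
move=> u0 u1; apply: sin_gt0_pi; rewrite !mulr_gt0 ?pi_gt0//=.
by have := pi_gt0 R; nra.
Qed.

Let G_ge0 t : `|t| <= 1 / 4 -> 0 <= G t.
Proof.
move=> ht; rewrite /G mulr_ge0// xsin_even.
have := dtau_lt _ ht; have [->|u0] := eqVneq (t - theta) 0.
  by rewrite normr0 mul0r.
move=> hu; rewrite mulr_ge0// ltW// sin2pi_gt0 ?normr_gt0//; move: theta_lt; lra.
Qed.

(** [G] depends on |t - theta| only, which ranges over the compact interval [r, dl] inside ]0, 1/2[;
    the minimum there is positive. If [r] exceeds [dl] there is no such t. *)
Let G_away r : 0 < r -> exists2 k, 0 < k &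
  forall t, `|t| <= 1 / 4 -> r <= `|t - theta| -> k <= G t.
Proof.
move=> r0; pose dl := 1 / 4 + `|theta|.
have af1 : 0 < `|a * f1| by rewrite normr_gt0 mulf_neq0.
have [rd|rd] := leP r dl; last first.
  exists 1 => // t ht rt; have := dtau_lt _ ht; rewrite -/dl; lra.
pose F (u : R) := u * sin (2 * pi * u).
have cF : {within `[r, dl], continuous F}.
  apply: continuous_subspaceT => u; apply: cvgM; first exact: cvg_id.
  apply: (@continuous_comp _ _ _ (fun u => 2 * pi * u) sin); last exact: continuous_sin.
  by apply: cvgM; [exact: cvg_cst|exact: cvg_id].
have [c cI cmin] := EVT_min rd cF.
exists (`|a * f1| * F c).
  move: cI; rewrite in_itv/= => /andP[rc cd]; rewrite mulr_gt0// /F mulr_gt0//.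
    exact: lt_le_trans rc.
  apply: sin2pi_gt0; first exact: lt_le_trans rc.
  by apply: (le_lt_trans cd); rewrite /dl; move: theta_lt; lra.
move=> t ht rt; rewrite /G ler_wpM2l// xsin_even; apply: cmin.
by rewrite in_itv/= rt dtau_lt.
Qed.

Let mG : measurable_fun [set: R] G.
Proof.
apply: continuous_measurable_fun => t; apply: cvgM; first exact: cvg_cst.
apply: cvgM; first by apply: cvgB; [exact: cvg_id|exact: cvg_cst].
by apply: trig_affine_cont; exact: continuous_sin.
Qed.

Lemma thetahat_cvg : {ae P, forall x, tau n x @[n --> \oo] --> theta}.
Proof.
pose B := Num.max gm^-1 (gm^-1 * Mff).
have B1 t x : `|k1 t x| <= B.
  by rewrite /B le_max normrM; apply/orP; right; apply: ler_pM.
have B2 t x : `|k2 t x| <= B by rewrite /B le_max k2_le.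
exact: (robbins_monro_cvg _ _ _ _ zeta zeta_indep N e_sqr e_var e_mean tau k1 k2 G theta B
  tau_adapted tau_bnd (ltW theta_lt) tauS' mk1 mk2 B1 B2 mG G_ge0 G_drift G_away).
Qed.

Let abs_noise_sum_le :
  {ae P, forall x, exists C, forall n, \sum_(i < n) (1 + `|e i x|) <= C * n%:R}.
Proof.
have := slln_abs_noise _ _ _ _ zeta zeta_indep N e_sqr e_var.
apply: filterS => x h.
have [C HC] := sum_le_of_mean (fun i => `|e i x|) _ _
  (mean_abs_noise_le _ _ _ _ zeta N e_sqr e_var) h.
exists (C + 1) => n; rewrite big_split/= sumr_const card_ord.
by rewrite mulrDl mul1r addrC lerD2r; exact: HC.
Qed.

(** With theta in place of tau_i this is [slln_inverse_density] for a fixed cosine. The replacement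
    costs at most a constant times (1 + |e_i|) [dl i], whose averages vanish by
    [weighted_cesaro]. *)
Lemma ahat_cvg :
  {ae P, forall x, (1 / (n%:R * f1) *
    \sum_(i < n) cos (2 * pi * (X i x - tau i x)) / g (X i x) * y i x) @[n --> \oo] --> a}.
Proof.
have cos_le (x : R) : `|cos x| <= 1 by rewrite ler_norml cos_geN1 cos_le1.
have h1 := slln_inverse_density (fun x => cos (2 * pi * (x - theta))) 1
  (trig_affine_cont _ _ (@continuous_cos R)) (fun x => cos_le _).
apply: (filterS3 _ _ h1 thetahat_cvg abs_noise_sum_le) => x {}h1 h2 [C HC].
(* By the addition formula [dl i] bounds the change of the cosine uniformly in [X i], and it tends
   to 0 with tau_i - theta. *)
pose dl i := `|cos (2 * pi * tau i x) - cos (2 * pi * theta)| +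
             `|sin (2 * pi * tau i x) - sin (2 * pi * theta)|.
have dl0 : dl n @[n --> \oo] --> (0 : R).
  rewrite -[X in _ --> X]addr0; apply: cvgD.
    rewrite -(@normr0 _ R); apply: cvg_norm; rewrite -(subrr (cos (2 * pi * theta))).
    apply: cvgB; last exact: cvg_cst.
    apply: (@cvg_comp _ _ _ (fun n => 2 * pi * tau n x) cos _ (nbhs (2 * pi * theta))).
      by apply: cvgM => //; exact: cvg_cst.
    exact: continuous_cos.
  rewrite -(@normr0 _ R); apply: cvg_norm; rewrite -(subrr (sin (2 * pi * theta))).
  apply: cvgB; last exact: cvg_cst.
  apply: (@cvg_comp _ _ _ (fun n => 2 * pi * tau n x) sin _ (nbhs (2 * pi * theta))).
    by apply: cvgM => //; exact: cvg_cst.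
  exact: continuous_sin.
pose z i := (cos (2 * pi * (X i x - tau i x)) - cos (2 * pi * (X i x - theta))) /
  g (X i x) * y i x.
have Mff0 : 0 <= Mff by exact: le_trans (normr_ge0 _) (ff_le 0).
have gm0' : 0 <= gm^-1 by rewrite invr_ge0 ltW.
pose B := gm^-1 * (Mff + 1).
have B0 : 0 <= B by rewrite mulr_ge0// addr_ge0.
have zle i : `|z i| <= B * ((1 + `|e i x|) * dl i).
  have y1 : `|y i x| <= (Mff + 1) * (1 + `|e i x|).
    apply: (le_trans (ler_normD _ _)); have := ff_le (X i x); rewrite /ff => hf.
    have := normr_ge0 (e i x); nra.
  have c1 : `|cos (2 * pi * (X i x - tau i x)) - cos (2 * pi * (X i x - theta))| <= dl i.
    rewrite !mulrBr !cosB.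
    set cx := cos (2 * pi * X i x); set sx := sin (2 * pi * X i x).
    have -> : forall p q r s : R, cx * p + sx * q - (cx * r + sx * s) =
      cx * (p - r) + sx * (q - s) by move=> *; ring.
    apply: (le_trans (ler_normD _ _)); rewrite /dl !normrM; apply: lerD.
      by rewrite ler_piMl// cos_le.
    by rewrite ler_piMl// sin_le.
  rewrite /z normrM [`|_ / _|]normrM.
  have -> : B * ((1 + `|e i x|) * dl i) = dl i * gm^-1 * ((Mff + 1) * (1 + `|e i x|)).
    by rewrite /B; ring.
  by apply: ler_pM => //; exact: ler_pM.
have w0 i : 0 <= 1 + `|e i x| by exact: addr_ge0.
have hz : (n%:R^-1 * \sum_(i < n) z i) @[n --> \oo] --> (0 : R).
  have hw := weighted_cesaro dl0 w0 HC.
  have hB : (B * (n%:R^-1 * \sum_(i < n) (1 + `|e i x|) * dl i)) @[n --> \oo] --> (B * 0 : R).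
    by apply: cvgM; [exact: cvg_cst|exact: hw].
  rewrite mulr0 in hB.
  apply/cvgrPdist_le => eps eps0; move/cvgrPdist_le : hB => /(_ _ eps0).
  apply: filterS => n; rewrite !sub0r !normrN; apply: le_trans.
  rewrite (ger0_norm (x := B * _)); last first.
    apply: mulr_ge0 => //; apply: mulr_ge0 => //; apply: sumr_ge0 => i _.
    by apply: mulr_ge0 => //; rewrite /dl addr_ge0.
  rewrite normrM ger0_norm// mulrCA ler_wpM2l// mulr_sumr.
  apply: (le_trans (ler_norm_sum _ _ _)); apply: ler_sum => i _; exact: zle.
rewrite Rint_cos in h1.
have ha : (f1^-1 * (n%:R^-1 * \sum_(i < n) cos (2 * pi * (X i x - theta)) / g (X i x) * y i x +
   n%:R^-1 * \sum_(i < n) z i)) @[n --> \oo] --> (f1^-1 * (a * f1 + 0)).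
  by apply: cvgM; [exact: cvg_cst|exact: cvgD].
apply: (cvg_near_eq ha); first by rewrite addr0 mulrC mulfK.
near=> n; rewrite -mulrDr -big_split/= mulrA div1r invfM [_^-1 * f1^-1]mulrC.
congr (_ * _); apply: eq_bigr => i _; rewrite /z; ring.
Unshelve. all: by end_near. Qed.

Section nadaraya_watson.
Variables (K : R -> R) (MK w alpha x0 v0 : R).
Hypothesis K_meas : measurable_fun setT K.
Hypothesis K_ge0 : forall x, 0 <= K x.
Hypothesis K_sym : forall x, K (- x) = K x.
Hypothesis K_int : (\int[mu]_x (K x)%:E = 1)%E.
Hypothesis K_le : forall x, K x <= MK.
Hypothesis w_gt0 : 0 < w.
Hypothesis K_supp : forall x, K x != 0 -> `|x| <= w.
Hypotheses (alpha_gt0 : 0 < alpha) (alpha_lt1 : alpha < 1).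
Hypothesis x0_in : x0 \in `[- (1 / 2), 1 / 2].

(** The bandwidth of observation i+1, in accordance with the indexing from 0. *)
Let h i : R := 1 / i.+1%:R `^ alpha.
Let psi i t x := 1 / h i * K ((x - (t + x0)) / h i) + 1 / h i * K ((x - (t - x0)) / h i).
Let Wt i x := psi i (tau i x) (X i x).

Let h_gt0 i : 0 < h i. Proof. by rewrite divr_gt0// powR_gt0. Qed.

Let hinv i : 1 / h i = i.+1%:R `^ alpha. Proof. by rewrite /h !div1r invrK. Qed.

Let Kh_ge0 i x : 0 <= 1 / h i * K x.
Proof. by rewrite mulr_ge0// divr_ge0// ltW. Qed.

Let psi_ge0 i t x : 0 <= psi i t x. Proof. exact: addr_ge0. Qed.

Let psi_le i t x : psi i t x <= 2 * MK * i.+1%:R `^ alpha.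
Proof.
rewrite /psi -mulrDr hinv mulrC ler_wpM2r ?powR_ge0//.
have -> : 2 * MK = MK + MK by ring.
exact: lerD.
Qed.

Let mpsi i : measurable_fun [set: R * R] (fun p => psi i p.1 p.2).
Proof.
have mm c : measurable_fun [set: R * R] (fun p : R * R => 1 / h i * K ((p.2 - (p.1 + c)) / h i)).
  apply: measurable_funM => //; apply: measurableT_comp => //.
  apply: measurable_funM => //; apply: measurable_funB => //; exact: measurable_funD.
exact: (measurable_funD (mm x0) (mm (- x0))).
Qed.

Let intK i c : intg (fun x => 1 / h i * K ((X i x - c) / h i)).
Proof.
apply: (@intg_bounded _ _ _ _ _ (1 / h i * MK)).
  apply: measurable_funM => //; apply: measurableT_comp => //.
  by apply: measurable_funM => //; exact: measurable_funB.
by move=> x; rewrite ger0_norm// ler_wpM2l// divr_ge0// ltW.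
Qed.

Let psi_mean_le i t : \int[P]_x psi i t (X i x) <= 2 * gM.
Proof.
rewrite RintegralD//.
have -> : 2 * gM = gM + gM by ring.
by apply: lerD; apply: (kernel_mean_le _ _ _ _ g g_pdf _ (X_dens i)).
Qed.

(* One of the two windows, around t + x0 and t - x0, keeps at least half of its
   mass inside the support of the density. *)
Let psi_mean_ge i t : w * h i <= 1 / 4 -> `|t| <= 1 / 4 ->
  gm / 2 <= \int[P]_x psi i t (X i x).
Proof.
move=> wh; rewrite ler_norml => /andP[t1 t2].
have := x0_in; rewrite in_itv/= => /andP[x1 x2].
rewrite RintegralD//.
have Kge c : (- (1 / 2) <= c - w * h i /\ c <= 1 / 2) \/
             (- (1 / 2) <= c /\ c + w * h i <= 1 / 2) ->
    gm / 2 <= \int[P]_x (1 / h i * K ((X i x - c) / h i)).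
  move=> side; apply: (kernel_mean_ge _ _ _ _ g g_pdf _ (X_dens i) K _ _ _ _ _ _ _ MK _ gm w) => //.
  exact: ltW.
have K0 c : 0 <= \int[P]_x (1 / h i * K ((X i x - c) / h i)).
  by apply: Rintegral_ge0.
(* The centre chosen is the one in which t and the shift have opposite signs. For t >= 0 it lies in
   [-1/2, 1/4], so a half window of length at most 1/4 fits on its right; for t < 0 the picture is
   mirrored. *)
have [t0'|t0'] := leP 0 t; have [x0'|x0'] := leP 0 x0.
- by apply: (le_trans (Kge (t - x0) _)); [right; split; lra|rewrite lerDr].
- by apply: (le_trans (Kge (t + x0) _)); [right; split; lra|rewrite lerDl].
- by apply: (le_trans (Kge (t + x0) _)); [left; split; lra|rewrite lerDl].
- by apply: (le_trans (Kge (t - x0) _)); [left; split; lra|rewrite lerDr].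
Qed.

Let h_cvg0 : h n @[n --> \oo] --> (0 : R). Proof. exact: powR_inv_cvg0. Qed.

Let vh n x := if n == 0%N then v0 else n%:R^-1 * \sum_(i < n) y i x / g (X i x).

(** Where the weight is positive, [X i] is within w h_i of tau_i + x0 or tau_i - x0, so f(X_i -
    theta) is within L (w h_i + |tau_i - theta|) of f(x0) or f(-x0), which are equal. This bias
    vanishes along each path. *)
Lemma nadaraya_watson_cvg :
  {ae P, forall x, ((\sum_(i < n) Wt i x * (y i x - vh i x)) / (\sum_(i < n) Wt i x))
     @[n --> \oo] --> a * f x0}.
Proof.
have s1 := slln_weights _ _ _ _ zeta zeta_indep tau psi (2 * gM) (2 * MK) alpha (ltW alpha_gt0)
  alpha_lt1 tau_adapted mpsi psi_ge0 psi_le psi_mean_le.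
have s2 := slln_weighted_noise _ _ _ _ zeta zeta_indep N e_sqr e_var e_mean tau psi (2 * gM)
  (2 * MK) alpha (ltW alpha_gt0) alpha_lt1 tau_adapted mpsi psi_ge0 psi_le psi_mean_le.
have s3 : {ae P, forall x, vh n x @[n --> \oo] --> v}.
  apply: filterS vhat_cvg => x hx; apply: (cvg_near_eq hx) => //; near=> n.
  rewrite /vh ifF//; apply/negbTE; rewrite -lt0n; near: n; exact: nbhs_infty_gt.
apply: (filterS3 _ _ (filterI s1 s2) s3 thetahat_cvg) => x [{}s1 {}s2] {}s3 s4.
have [N0 _ HN0] : \forall n \near \oo, w * h n <= 1 / 4.
  have e0 : 0 < 1 / 4 / w :> R by rewrite !divr_gt0.
  move/cvgrPdist_le : h_cvg0 => /(_ _ e0); apply: filterS => n.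
  by rewrite sub0r normrN gtr0_norm// ler_pdivlMr// mulrC.
have W0 i : 0 <= Wt i x by exact: psi_ge0.
have [C HC] := sum_le_of_mean (fun i => Wt i x) _ _ (fun i => psi_mean_le i (tau i x)) s1.
have m0 i : 0 <= \int[P]_y psi i (tau i x) (X i y) by apply: Rintegral_ge0.
have low := mean_lower_bound (fun i => Wt i x) _ (gm / 2) N0 ltac:(by rewrite divr_gt0)
  m0 (fun i Ni => psi_mean_ge i (tau i x) (HN0 i Ni) (tau_bnd i x)) s1.
(* Set to 0 where the weight vanishes, since there [X i] may be far from both windows and the
   difference of values of [f] need not be small. *)
pose r i := if Wt i x == 0 then 0 else a * (f (X i x - theta) - f x0) + (v - vh i x).
have r0 : r n @[n --> \oo] --> (0 : R).
  have hd : (`|a| * (L * (w * h n + `|tau n x - theta|)) + `|v - vh n x|) @[n --> \oo] -->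
      (`|a| * (L * (w * 0 + `|theta - theta|)) + `|v - v|).
    apply: cvgD; last by apply: cvg_norm; apply: cvgB => //; exact: cvg_cst.
    apply: cvgM; first exact: cvg_cst.
    apply: cvgM; first exact: cvg_cst.
    apply: cvgD; first by apply: cvgM; [exact: cvg_cst|exact: h_cvg0].
    by apply: cvg_norm; apply: cvgB => //; exact: cvg_cst.
  rewrite !subrr normr0 mulr0 !addr0 !mulr0 in hd.
  apply/cvgrPdist_le => eps eps0; move/cvgrPdist_le : hd => /(_ _ eps0).
  apply: filterS => n; rewrite !sub0r !normrN; apply: le_trans.
  have hb : 0 <= `|a| * (L * (w * h n + `|tau n x - theta|)) + `|v - vh n x|.
    rewrite addr_ge0// mulr_ge0// mulr_ge0// ?(ltW L_gt0)// addr_ge0// mulr_ge0// ?(ltW w_gt0)//.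
    exact: ltW.
  rewrite (ger0_norm hb) /r; case: eqP => [_|/eqP Wn0]; first by rewrite normr0.
  apply: (le_trans (ler_normD _ _)); rewrite lerD2r normrM ler_wpM2l//.
  have close c : K ((X n x - (tau n x + c)) / h n) != 0 ->
      `|f (X n x - theta) - f c| <= L * (w * h n + `|tau n x - theta|).
    move=> /K_supp; rewrite normrM normfV (gtr0_norm (h_gt0 n)) ler_pdivrMr// => hc.
    apply: (le_trans (f_lip _ _)); rewrite ler_wpM2l// ?(ltW L_gt0)//.
    have -> : X n x - theta - c = (X n x - (tau n x + c)) + (tau n x - theta) by ring.
    by apply: (le_trans (ler_normD _ _)); rewrite lerD2r.
  have [K1|K1] := eqVneq (K ((X n x - (tau n x + x0)) / h n)) 0; last exact: close.
  have [K2|K2] := eqVneq (K ((X n x - (tau n x - x0)) / h n)) 0.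
    by move: Wn0; rewrite /Wt /psi K1 K2 !mulr0 addr0 eqxx.
  by rewrite -(f_sym x0); exact: close.
apply: (weighted_ratio_cvg (fun i => Wt i x) (fun i => e i x) r (fun i => y i x - vh i x)
  _ C (gm / 2 / 4)) => //.
- by rewrite !divr_gt0.
- move=> i; rewrite /r; case: eqP => [->|_]; first by rewrite !mul0r.
  by rewrite /y; congr (_ * _); ring.
Unshelve. all: by end_near. Qed.

End nadaraya_watson.
End curve.

(** * Recombination of the curves *)

Theorem theorem6p1
  (R : realType) (d : measure_display) (T : measurableType d)
  (P : probability T R)
  (p : nat) (p_ge2 : (2 <= p)%N)
  (* observation times X_i, i >= 1 *)
  (g : R -> R) (X : nat -> {RV P >-> R})
  (g_pdf : is_pdf g)
  (g_supp : fun_support g = `[- (1 / 2), 1 / 2]%classic)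
  (g_pos : forall x : R, x \in `[- (1 / 2), 1 / 2] -> 0 < g x)
  (g_reg : regular_on_segment (- (1 / 2)) (1 / 2) g)
  (X_indep : mutually_independent (fun i : nat => X i.+1))
  (X_dens : forall i : nat, (0 < i)%N -> has_density (X i) g)
  (* shape function *)
  (f : R -> R)
  (f_sym : forall x, f (- x) = f x)
  (f_bnd : bounded_fun f)
  (f_per : forall x, f (x + 1) = f x)
  (f_int : \int[lebesgue_measure]_(x in `[- (1 / 2), 1 / 2]) f x = 0)
  (f1_neq0 : fourier1 f != 0)
  (f_lip : lipschitz f)
  (* parameters *)
  (a theta v : 'I_p -> R)
  (a_neq0 : forall j, a j != 0)
  (a_first : forall j : 'I_p, nat_of_ord j = 0%N -> a j = 1)
  (theta_first : forall j : 'I_p, nat_of_ord j = 0%N -> theta j = 0)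
  (theta_lt : forall j, `|theta j| < 1 / 4)
  (* noise eps_{i,j}, i >= 1 *)
  (eps : nat -> 'I_p -> {RV P >-> R}) (sigma : 'I_p -> R)
  (eps_indep : mutually_independent
     (fun ij : nat * 'I_p => eps ij.1.+1 ij.2))
  (eps_mean : forall i j, (0 < i)%N -> ('E_P[eps i j] = 0)%E)
  (eps_var : forall i j, (0 < i)%N ->
     ('E_P[fun w => (eps i j w ^+ 2)%R] = (sigma j ^+ 2)%:E)%E)
  (eps_X_indep : independent_families
     (fun i : nat => X i.+1) (fun ij : nat * 'I_p => eps ij.1.+1 ij.2))
  (eps_id : forall j, identically_distributed (fun i : nat => eps i.+1 j))
  (eps_mom : exists2 r : R, 2 < r & forall i j, (0 < i)%N ->
     ('E_P[fun w => (`|eps i j w| `^ r)%R] < +oo)%E)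
  (* shape invariant model *)
  (Y : nat -> 'I_p -> T -> R)
  (Y_model : forall i j w, (0 < i)%N ->
     Y i j w = a j * f (X i w - theta j) + v j + eps i j w)
  (* estimators: initial values, kernel, bandwidth exponent, weights *)
  (theta0 v0 : 'I_p -> R)
  (theta0_in : forall j, theta0 j \in `[- (1 / 4), 1 / 4])
  (K : R -> R) (nu : R)
  (K_meas : measurable_fun setT K)
  (K_ge0 : forall x, 0 <= K x)
  (K_sym : forall x, K (- x) = K x)
  (K_bnd : bounded_fun K)
  (K_supp : compact (fun_support K))
  (K_int : (\int[lebesgue_measure]_x (K x)%:E)%E = 1%E)
  (K2_int : (\int[lebesgue_measure]_x (K x ^+ 2)%:E)%E = (nu ^+ 2)%:E)
  (alpha : R) (alpha_gt0 : 0 < alpha) (alpha_lt1 : alpha < 1)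
  (omega : 'I_p -> R -> R)
  (omega_sym : forall j x, omega j (- x) = omega j x)
  (omega_ge0 : forall j x, 0 <= omega j x)
  (omega_sum : forall x, \sum_(j < p) omega j x = 1) :
  forall x : R, x \in `[- (1 / 2), 1 / 2] ->
  {ae P, forall w : T,
     fhat g a (fourier1 f) theta0 v0 K
       (fun n => 1 / (n%:R `^ alpha)) omega
       (fun i => X i w) (fun i j => Y i j w) n x @[n --> \oo] --> f x}.
Proof.
move=> x x_in.
have [Mf HMf] := bounded_fun_le f f_bnd.
have [L L0 HL] := lipschitz_le f f_lip.
have [MK0 HMK0] := bounded_fun_le K K_bnd.
have HMK t : K t <= MK0 by apply: le_trans (HMK0 t); exact: ler_norm.
have [w w0 Hw] := compact_support_le K K_supp.
have [g_cont _ _ _] := g_reg.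
have [g_out [gm gm0 [gM [g_ge g_le]]]] := pdf_segment g g_supp g_pos g_cont.
set est := fun n (w : T) (j : 'I_p) => fhat_comp g a (fourier1 f) theta0 v0 K
  (fun n => 1 / (n%:R `^ alpha)) (fun i => X i w) (fun i j => Y i j w) n j x.
(* Each curve alone estimates f(x); finitely many almost sure events intersect, and the weights sum
   to 1. *)
suff comp j : {ae P, forall w, est n w j @[n --> \oo] --> f x}.
  have hall : {ae P, forall w, forall j, est n w j @[n --> \oo] --> f x}.
    exact: filter_forall comp.
  apply: filterS hall => w' cw.
  have hs : \sum_(j <- index_enum 'I_p) omega j x * est n w' j @[n --> \oo] -->
      \sum_(j <- index_enum 'I_p) omega j x * f x.
    apply: (cvg_sum (u := fun j n => omega j x * est n w' j) (l := fun j => omega j x * f x)) => j.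
    by apply: cvgM; [exact: cvg_cst|exact: cw].
  apply: (cvg_near_eq hs); first by rewrite -mulr_suml omega_sum mul1r.
  by near=> n; rewrite /fhat /est.
(* With curve [j] fixed, even positions carry the observation times and odd positions the noise of
   that curve, both starting at observation 1. *)
pose zeta k : {RV P >-> R} := if odd k then eps k./2.+1 j else X k./2.+1.
have zX i : zeta i.*2 = X i.+1 by rewrite /zeta odd_double doubleK.
have zE i : zeta i.*2.+1 = eps i.+1 j by rewrite /zeta /= odd_double/= uphalf_double.
have zeta_indep : forall n (B : nat -> set R), (forall i, measurable (B i)) ->
  P (\big[setI/setT]_(i < n) (zeta i @^-1` B i)) =
  (\prod_(i < n) P (zeta i @^-1` B i))%E.
  move=> n B mB.
  apply: (@interleave_indep _ _ _ P (nat * 'I_p)%type (fun i => X i.+1)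
    (fun ij => eps ij.1.+1 ij.2) (fun i => (i, j)) _ X_indep eps_indep eps_X_indep n B mB).
  by move=> i k [].
have z_dens i : has_density (zeta i.*2) g by rewrite zX; exact: X_dens.
have e_sqr i : P.-integrable [set: T] (EFin \o (fun x => zeta i.*2.+1 x ^+ 2)).
  rewrite zE; apply/integrableP; split.
    by apply/measurable_EFinP; exact: measurable_funX.
  have := eps_var i.+1 j isT; rewrite unlock => ev.
  under eq_integral do rewrite /= ger0_norm ?sqr_ge0//.
  by rewrite ev ltry.
have e_var i : \int[P]_x (zeta i.*2.+1 x ^+ 2) <= sigma j ^+ 2.
  by rewrite zE /Rintegral; have := eps_var i.+1 j isT; rewrite unlock => ->.
have e_mean i : \int[P]_x zeta i.*2.+1 x = 0.
  by rewrite zE /Rintegral; have := eps_mean i.+1 j isT; rewrite unlock => ->.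
pose tau n w' := thetahat g a (fourier1 f) theta0 (fun i => X i w')
  (fun i j => Y i j w') n j.
have t0_le : `|theta0 j| <= 1 / 4.
  by have := theta0_in j; rewrite in_itv/= ler_norml.
have yE i w' : Y i.+1 j w' = a j * f (zeta i.*2 w' - theta j) + v j + zeta i.*2.+1 w'.
  by rewrite Y_model// zX zE.
have tauS i w' : tau i.+1 w' = proj_quarter (tau i w' +
  1 / i.+1%:R * Num.sg (a j * fourier1 f) *
   (sin (2 * pi * (zeta i.*2 w' - tau i w')) / g (zeta i.*2 w')) *
   (a j * f (zeta i.*2 w' - theta j) + v j + zeta i.*2.+1 w')).
  by rewrite -yE zX.
have hA := ahat_cvg _ _ _ P zeta zeta_indep g gm g_pdf g_out gm0 g_ge z_dens
  (sigma j ^+ 2) e_sqr e_var e_mean f Mf L f_sym f_per HMf L0 HL f1_neq0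
  (a j) (theta j) (v j) (a_neq0 j) (theta_lt j) (theta0 j) tau t0_le (fun=> erefl) tauS.
have hN := nadaraya_watson_cvg _ _ _ P zeta zeta_indep g gm gM g_pdf g_out gm0 g_ge g_le z_dens
  (sigma j ^+ 2) e_sqr e_var e_mean f Mf L f_sym f_per HMf L0 HL f_int f1_neq0
  (a j) (theta j) (v j) (a_neq0 j) (theta_lt j) (theta0 j) tau t0_le (fun=> erefl) tauS
  K MK0 w alpha x (v0 j) K_meas K_ge0 K_sym K_int HMK w0 Hw alpha_gt0 alpha_lt1 x_in.
apply: filterS2 hA hN => w' h1 h2.
(* The ratio tends to a f(x) and [ahat] to a, which is nonzero, so the inverse of [ahat] converges
   whatever its first values are. *)
apply: (cvg_near_eq (cvgM (cvgV (a_neq0 j) h1) h2)); first by rewrite mulKf.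
(* Sums from 1 to n are reindexed from 0, so that [thetahat i.-1] and [vhat i.-1] become the values
   at index i; at i = 0 the latter is the initial constant. *)
near=> n; rewrite /est /fhat_comp /ahat !big_add1 !big_mkord /=.
congr (_ * (_ / _)).
- rewrite [RHS]div1r; congr ((_ * _)^-1).
  by apply: eq_bigr => i _; rewrite -yE zX.
- apply: eq_bigr => i _; rewrite -yE zX /nw_weight /= !opprD !addrA opprK.
  congr (_ * (_ - _)); rewrite /vhat; case: eqP => // _.
  rewrite div1r; congr (_ * _); rewrite big_add1 big_mkord.
  by apply: eq_bigr => k _; rewrite yE zX.
- by apply: eq_bigr => i _; rewrite zX /nw_weight /= !opprD !addrA opprK.
Unshelve. all: by end_near. Qed.
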